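(* For every $n\ge 1$ there is a bijection $\Phi_n$ from the set of PDSAWs in the symmetric wedge with $n$ east steps to the set of matchings of $[2n]=\{1,\dots,2n\}$ such that, for every such PDSAW $P$ and all integers $N$, $A\in\{0,1\}$, $M$, the path $P$ has - exactly $N$ north steps, - area enclosed by $P$ and the line $y=-x$ of parity $A$, and - last descent of length $M-1$ if and only if the matching $\Phi_n(P)$ has - exactly $N$ nestings, - number of crossings of parity $A$, and - $1$ matched with $M$. Moreover, the bijections $\Phi_n$ ($n\ge1$) can be chosen so that factors are preserved with their order reversed (in particular the last factor of the PDSAW is mapped to the first factor of the matching): if $P_1,P_2,\dots,P_r$ are the consecutive prime factors of $P$, with $P_i$ having $n_i$ east steps, then the consecutive prime factors of the matching $\Phi_n(P)$, read from left to right, are $\Phi_{n_r}(P_r),\Phi_{n_{r-1}}(P_{r-1}),\dots,\Phi_{n_1}(P_1)$ (where each $P_i$ is translated so as to start at the origin, and each factor of the matching is relabelled order-preservingly to a matching of an initial interval $[2n_i]$).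
   Context: A partially directed self avoiding walk (PDSAW) is a walk in the plane starting at the origin and taking unit east, north and south steps, where a north step is never immediately followed or preceded by a south step. A PDSAW in the symmetric wedge is a PDSAW that stays within the (closed) wedge $\{(x,y): -x\le y\le x\}$ and ends at some point of the line $y=-x$; with $n$ east steps it therefore ends at $(n,-n)$. Such a walk is determined by the $y$-coordinates of its east steps. The length of the last descent is the number of south steps after the last east step. The area enclosed by the path and the line $y=-x$ is the number of full unit lattice squares lying between the line $y=-x$ and the path (triangles are disregarded). A matching of $[2n]$ is a partition of $[2n]$ into $n$ two-element blocks (matched pairs). A crossing is a pair of matched pairs $\{i,j\},\{k,l\}$ with $i<k<j<l$; a nesting is a pair of matched pairs $\{i,j\},\{k,l\}$ with $i<k<l<j$. A factor of a PDSAW in the symmetric wedge is a sub-path starting at $(a,-a)$ and ending at $(b,-b)$, for some $a<b$, such that all east steps of the PDSAW after the point $(a,-a)$ are (weakly) below the line $y=x-2a$, and all east steps of the PDSAW after the point $(b,-b)$ are (weakly) below the line $y=x-2b$. A factor of a matching is a sub-matching on an interval $\{a,a+1,\dots,b\}$ such that all elements of this interval are matched within the interval. A factor is prime if it contains no smaller factor. Every PDSAW in the symmetric wedge, and every matching, is the concatenation of its consecutive prime factors; the last factor of a PDSAW is its last prime factor and the first factor of a matching is its first (leftmost) prime factor.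
   Formalization: A factor of a matching is taken to be prime if it is not a concatenation of smaller factors; read literally, ''contains no smaller factor'' would leave {1,4},{2,3} without a decomposition into consecutive prime factors. *)

(* Defs.v *)
From HB Require Import structures.
From mathcomp Require Import all_boot all_order all_algebra.

Set Implicit Arguments.
Unset Strict Implicit.
Unset Printing Implicit Defensive.

Import Order.TTheory GRing.Theory Num.Theory.
Local Open Scope ring_scope.

Definition bijection_between (S T : Type) (A : pred S) (B : pred T)
    (f : S -> T) : Prop :=
  [/\ forall x, A x -> B (f x),
      forall x y, A x -> A y -> f x = f y -> x = y
    & forall z, B z -> exists2 x, A x & f x = z].

(** * Partially directed self avoiding walks *)

Inductive step := East | North | South.

Definition ord_of_step (s : step) : 'I_3 :=
  match s with East => inord 0 | North => inord 1 | South => inord 2 end.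

Definition step_of_ord (i : 'I_3) : step :=
  match val i with 0%N => East | 1%N => North | _ => South end.

Lemma ord_of_stepK : cancel ord_of_step step_of_ord.
Proof. by case; rewrite /step_of_ord /= inordK. Qed.

HB.instance Definition _ := Countable.copy step (can_type ord_of_stepK).

(* A walk is the word of its steps, so that translating a walk does not change
   it; the starting point is a separate argument where it matters. *)
Definition walk := seq step.

Definition point : Type := (int * int)%type.

Definition origin : point := (0, 0).

Definition move (p : point) (s : step) : point :=
  match s with
  | East => (p.1 + 1, p.2)
  | North => (p.1, p.2 + 1)
  | South => (p.1, p.2 - 1)
  end.

Definition endpoint (p : point) (w : walk) : point := foldl move p w.

Definition points (p : point) (w : walk) : seq point := p :: scanl move p w.

(* The left endpoints of the east steps. *)
Fixpoint east_steps (p : point) (w : walk) : seq point :=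
  match w with
  | [::] => [::]
  | East :: w' => p :: east_steps (move p East) w'
  | s :: w' => east_steps (move p s) w'
  end.

Definition opposite (s t : step) : bool :=
  (s == North) && (t == South) || (s == South) && (t == North).

Definition partially_directed (w : walk) : bool :=
  sorted (fun s t => ~~ opposite s t) w.

Definition in_wedge (p : point) : bool := - p.1 <= p.2 <= p.1.

Definition on_antidiagonal (p : point) : bool := p.2 == - p.1.

Definition pdsaw (n : nat) (w : walk) : bool :=
  [&& partially_directed w,
      all in_wedge (points origin w),
      on_antidiagonal (endpoint origin w)
    & count_mem East w == n].

Definition north_steps (w : walk) : nat := count_mem North w.

Definition last_descent (w : walk) : nat :=
  count_mem South (take (index East (rev w)) (rev w)).

(* The unit square [a, a + 1] x [b, b + 1] has no point strictly below y = -x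
   iff its lower left corner has none, and lies below the walk iff the east step
   in the column [a, a + 1] is at height at least b + 1. *)
Definition square_between (w : walk) (c : point) : bool :=
  (- c.1 <= c.2) &&
  has (fun e => (e.1 == c.1) && (c.2 + 1 <= e.2)) (east_steps origin w).

(* With L the length of the walk, all squares enclosed lie in
   [0, L] x [- L, L]; the second index is shifted by L. *)
Definition area (w : walk) : nat :=
  let L := size w in
  #|[set c : 'I_L * 'I_(2 * L) |
      square_between w ((c.1 : nat)%:Z, (c.2 : nat)%:Z - L%:Z)]|.

(* An east step is weakly below a line of slope 1 iff its left endpoint is. *)
Definition weakly_below_from (p e : point) : bool := e.2 <= e.1 - 2 * p.1.

(* [u] is a factor of the walk [pre ++ u ++ post], in that position. *)
Definition walk_factor (pre u post : walk) : bool :=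
  let p := endpoint origin pre in
  let q := endpoint p u in
  [&& on_antidiagonal p, on_antidiagonal q, p.1 < q.1,
      all (weakly_below_from p) (east_steps p (u ++ post))
    & all (weakly_below_from q) (east_steps q post)].

Definition prime_walk_factor (pre u post : walk) : Prop :=
  walk_factor pre u post /\
  forall u1 v u2 : walk, u = u1 ++ v ++ u2 ->
    walk_factor (pre ++ u1) v (u2 ++ post) -> v = u.

(* [ws] lists the consecutive prime factors of [w]. *)
Definition walk_prime_factors (w : walk) (ws : seq walk) : Prop :=
  flatten ws = w /\
  forall us u vs, ws = us ++ u :: vs ->
    prime_walk_factor (flatten us) u (flatten vs).

(** * Matchings *)

(* A matching of {1, ..., d} is a set of blocks over 'I_d, the ordinal i
   standing for the element i + 1. *)
Definition is_matching (d : nat) (m : {set {set 'I_d}}) : bool :=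
  partition m [set: 'I_d] && [forall B in m, #|B| == 2%N].

(* The bounds determine (i, j, k, l) from the two blocks, so every crossing, and
   every nesting, is counted once. *)
Definition crossings (d : nat) (m : {set {set 'I_d}}) : nat :=
  #|[set q : 'I_d * 'I_d * 'I_d * 'I_d | let: (i, j, k, l) := q in
      [&& [set i; j] \in m, [set k; l] \in m, (i < k)%N, (k < j)%N & (j < l)%N]]|.

Definition nestings (d : nat) (m : {set {set 'I_d}}) : nat :=
  #|[set q : 'I_d * 'I_d * 'I_d * 'I_d | let: (i, j, k, l) := q in
      [&& [set i; j] \in m, [set k; l] \in m, (i < k)%N, (k < l)%N & (l < j)%N]]|.

Definition matched (d : nat) (m : {set {set 'I_d}}) (x y : int) : Prop :=
  exists i j : 'I_d,
    [/\ x = (i.+1)%:Z, y = (j.+1)%:Z & [set i; j] \in m].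

(* The interval consists of the ordinals i with a <= i < b, that is of the
   elements a + 1, ..., b. *)
Definition interval (d a b : nat) : {set 'I_d} := [set i : 'I_d | (a <= i < b)%N].

Definition matching_factor (d : nat) (m : {set {set 'I_d}}) (a b : nat) : bool :=
  (a < b <= d)%N &&
  [forall i in interval d a b, exists j in interval d a b, [set i; j] \in m].

(* A prime factor is one that is not a concatenation of smaller factors. A
   smaller factor nested strictly inside is allowed: otherwise {1, 4}, {2, 3}
   would have no decomposition into consecutive prime factors. *)
Definition prime_matching_factor (d : nat) (m : {set {set 'I_d}}) (a b : nat) :
    Prop :=
  matching_factor m a b /\
  forall c : nat, (a < c < b)%N ->
    ~ (matching_factor m a c /\ matching_factor m c b).

(* The blocks inside the interval of length k starting after a, relabelled by
   i |-> i - a. *)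
Definition submatching (d : nat) (m : {set {set 'I_d}}) (a k : nat) :
    {set {set 'I_k}} :=
  [set [set i : 'I_k | [exists x in B, x == a + i :> nat]%N]
    | B : {set 'I_d} in m & B \subset interval d a (a + k)].

Definition sized_matching : Type := {d : nat & {set {set 'I_d}}}.

Definition Sized (d : nat) (m : {set {set 'I_d}}) : sized_matching :=
  existT (fun d : nat => {set {set 'I_d}}) d m.

Definition total_size (ms : seq sized_matching) : nat :=
  (\sum_(f <- ms) tag f)%N.

(* [ms] lists, from left to right, the relabelled consecutive prime factors of
   [m]. *)
Definition matching_prime_factors (d : nat) (m : {set {set 'I_d}})
    (ms : seq sized_matching) : Prop :=
  total_size ms = d /\
  forall us f vs, ms = us ++ f :: vs ->
    let a := total_size us in
    prime_matching_factor m a (a + tag f) /\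
    submatching m a (tag f) = tagged f.

(* Main.v *)
Require Import Defs.
From mathcomp Require Import all_boot all_order all_algebra zify ring.

(* A walk is determined by the heights a_1, ..., a_n of its east steps above the
   line y = -x, subject only to 0 <= a_i <= 2 (i - 1).  A matching in which 1 is
   matched with a_n + 2 is determined by a_n and by the matching left after
   removing that pair, hence by a sequence of the same kind.  In both codings
   the parity of the sum of the a_i is that of the area, resp. of the number of
   crossings, a_n gives the last statistic, and the prime factors of the object
   are the irreducible blocks of its sequence, in opposite orders.

   Equidistribution of north steps and nestings is proved with generating
   functions.  Summing over the matchings with a given Dyck word of openers and
   closers gives a product of (p, s)-integers [h] over its closers, so with
   (X f) h = f (h + 1), (Y f) h = [h] f (h - 1) and T_q = X + q Y, the matchings
   of [2m + 2] with a_(m + 1) = a sum to s^a (T_p^a T_1^(2m - a) delta) 0.  The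
   recurrence for walks follows from X Y - p Y X = (multiplication by s^h).

   As the statistics are additive over factors, the prime sequences are
   equidistributed too, and a bijection between them extends multiplicatively. *)

Set Implicit Arguments.
Unset Strict Implicit.
Unset Printing Implicit Defensive.

Import Order.TTheory GRing.Theory Num.Theory.

(** * Codes *)

(* Codes are listed from a_n down to a_1. *)
Fixpoint valid (c : seq nat) : bool :=
  if c is a :: c' then (a <= 2 * size c') && valid c' else true.

Fixpoint codes (n : nat) : seq (seq nat) :=
  if n is m.+1 then [seq a :: c | a <- iota 0 (2 * m).+1, c <- codes m]
  else [:: [::]].

Arguments codes : simpl never.

(** An east step raises the height above y = -x by one, so the next column is entered at height
    [(head 0 c').+1]; truncated subtraction counts the north steps from there and gives 0 for a
    descent. *)
Fixpoint norths (c : seq nat) : nat :=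
  if c is a :: c' then (a - (head 0 c').+1) + norths c' else 0.

(* The openers ([false]) and closers ([true]) of the matching coded by [c]. *)
Fixpoint word (c : seq nat) : seq bool :=
  if c is a :: c' then false :: take a (word c') ++ true :: drop a (word c')
  else [::].

(** The pair inserted last opens at the leftmost point, so the pairs nested in it are those whose
    closer is among the first [a] letters. *)
Fixpoint nests (c : seq nat) : nat :=
  if c is a :: c' then count id (take a (word c')) + nests c' else 0.

Lemma mem_codes n c : (c \in codes n) = valid c && (size c == n).
Proof.
elim: n c => [|n IHn] c.
  by rewrite inE; case: c => //= a c; rewrite andbF.
apply/idP/idP => [/allpairsP[[b d] [+ + ->]]|].
  by rewrite mem_iota IHn /= => le_b /andP[-> /eqP ->]; rewrite eqxx -ltnS le_b.
case: c => // a c /andP[/andP[le_a vc] /eqP[sz]].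
apply: allpairs_f.
  by rewrite (mem_iota 0 (2 * n).+1) ltnS -sz.
by rewrite IHn [valid c]vc sz eqxx.
Qed.

Lemma codes_uniq n : uniq (codes n).
Proof.
elim: n => // n IHn; apply: allpairs_uniq => //; first exact: iota_uniq.
by move=> [a c] [b d] _ _ /= [-> ->].
Qed.

Lemma big_codesS (R : Type) (idx : R) (op : Monoid.law idx) n F :
  \big[op/idx]_(c <- codes n.+1) F c =
  \big[op/idx]_(a < (2 * n).+1) \big[op/idx]_(c <- codes n) F ((a : nat) :: c).
Proof.
rewrite big_allpairs_dep -[iota 0 _]/(index_iota 0 (2 * n).+1) big_mkord.
by [].
Qed.

Lemma valid_cat c1 c2 : valid c1 -> valid c2 -> valid (c1 ++ c2).
Proof.
move=> + v2; elim: c1 => //= a c1 IH /andP[le_a /IH ->].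
by rewrite size_cat andbT; lia.
Qed.

Lemma valid_catr c1 c2 : valid (c1 ++ c2) -> valid c2.
Proof. by elim: c1 => //= a c1 IH /andP[_ /IH]. Qed.

Lemma size_word c : valid c -> size (word c) = 2 * size c.
Proof.
elim: c => //= a c IH /andP[le_a /IH sz].
by rewrite size_cat /= addnS -size_cat cat_take_drop sz mulnS.
Qed.

(** Validity of [c1] keeps each of its insertions inside the word built from [c1] alone, so the word
    of [c2] stays intact on the right. *)
Lemma word_cat c1 c2 : valid c1 -> word (c1 ++ c2) = word c1 ++ word c2.
Proof.
elim: c1 => //= a c IH /andP[le_a vc].
rewrite IH // take_cat drop_cat size_word //.
case: ltnP => [_|ge_a]; first by rewrite -catA.
have -> : a = size (word c) by rewrite size_word //; lia.
by rewrite -size_word // subnn take0 drop0 cats0 take_size drop_size -catA.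
Qed.

Lemma nests_cat c1 c2 : valid c1 -> nests (c1 ++ c2) = nests c1 + nests c2.
Proof.
elim: c1 => //= a c IH /andP[le_a vc].
rewrite IH // word_cat // takel_cat ?size_word //; lia.
Qed.

(** The last entry of a nonempty valid [c1] is 0, so the junction with [c2] contributes no north
    step. *)
Lemma norths_cat c1 c2 : valid c1 -> norths (c1 ++ c2) = norths c1 + norths c2.
Proof.
elim: c1 => //= a [|b c] IH /andP[le_a vc].
  by move: le_a; rewrite muln0 leqn0 => /eqP ->.
by rewrite IH //= addnA.
Qed.

(** * Equidistribution of north steps and nestings *)

Section Equidistribution.
Local Open Scope ring_scope.
Variables (R : comNzRingType) (p s : R).
Hypothesis ss : s * s = 1.

(** The (p, s)-integer [h], the sum of p^i s^j over i + j = h - 1. The variable [p] marks nestings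
    or north steps; [s], with [s * s = 1], marks the parity of the sum of a code. *)
Fixpoint qnat (h : nat) : R := if h is k.+1 then s ^+ k + p * qnat k else 0.

(* Lattice paths with [r] steps from height [h] down to 0, a down step from
   height k having weight [qnat k]. *)
Fixpoint dyck_sum (r h : nat) (phi : seq bool -> R) : R :=
  if r is r'.+1 then
    dyck_sum r' h.+1 (fun x => phi (false :: x))
    + qnat h * dyck_sum r' h.-1 (fun x => phi (true :: x))
  else (h == 0%N)%:R * phi [::].

Lemma eq_dyck_sum r h phi psi : phi =1 psi -> dyck_sum r h phi = dyck_sum r h psi.
Proof.
elim: r h phi psi => [|r IH] h phi psi E /=; first by rewrite E.
by congr (_ + _ * _); apply: IH => x; apply: E.
Qed.

Lemma dyck_sumZ r h k phi : dyck_sum r h (fun x => k * phi x) = k * dyck_sum r h phi.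
Proof.
elim: r h phi => [|r IH] h phi /=; first by ring.
by rewrite !IH; ring.
Qed.

(* Choosing the closer of the outermost arc among the down steps telescopes
   [h + 1] = s^h + p [h]. *)
Lemma dyck_sum_insert r h phi :
  dyck_sum r.+1 h.+1 phi =
  \sum_(a < r.+1) s ^+ (a + h) *
    dyck_sum r h (fun x => p ^+ count id (take a x) *
                           phi (take a x ++ true :: drop a x)).
Proof.
elim: r h phi => [|r IH] h phi.
  rewrite big_ord_recl big_ord0 /=; case: h => [|h] /=; ring.
rewrite big_ord_recl add0n.
rewrite -[LHS]/(dyck_sum r.+1 h.+2 (fun x => phi (false :: x)) +
  (s ^+ h + p * qnat h) * dyck_sum r.+1 h (fun x => phi (true :: x))) IH.
rewrite [dyck_sum r.+1 h (fun x => p ^+ count id (take ord0 x) * _)](_ : _ =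
  dyck_sum r.+1 h (fun x => phi (true :: x))); last first.
  by apply: eq_dyck_sum => x; rewrite take0 drop0 mul1r.
(* The summand s^h of [h + 1] is the term a = 0, where the chosen closer comes first. In everything
   else another letter comes first, and the induction hypothesis applies after it. *)
rewrite mulrDl addrCA; congr (_ + _).
case: h => [|h].
  rewrite /= mulr0 mul0r addr0; apply: eq_bigr => i _.
  by rewrite /= mul0r addr0 /bump /= !add1n addn1 addn0.
rewrite IH mulr_sumr -big_split; apply: eq_bigr => i _.
rewrite lift0.
have -> : s ^+ (i + h.+2) = s ^+ (i + h) by rewrite !addnS !exprS mulrA ss mul1r.
have -> : s ^+ (i.+1 + h.+1) = s ^+ (i + h) by rewrite addnS addSn !exprS mulrA ss mul1r.
rewrite -[dyck_sum r.+1 h.+1 _]/(dyck_sum r h.+2 _ + qnat h.+1 * dyck_sum r h _).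
rewrite [X in _ = _ * (_ + _ * X)](_ : _ =
  p * dyck_sum r h (fun x => p ^+ count id (take i x) *
                             phi (true :: take i x ++ true :: drop i x))).
  by rewrite /=; ring.
by rewrite -dyck_sumZ; apply: eq_dyck_sum => x; rewrite /= exprS mulrA.
Qed.

Definition code_weight (f : seq nat -> nat) c : R := p ^+ f c * s ^+ sumn c.

(** Iterates [dyck_sum_insert]: at height 0 the first letter is an opener, since [0] = 0, and the
    position of its closer is the head of the code. The test function [phi] carries the weights of
    later insertions. *)
Lemma sum_nests_word m phi :
  \sum_(c <- codes m) code_weight nests c * phi (word c) = dyck_sum (2 * m) 0 phi.
Proof.
elim: m phi => [|m IH] phi.
  by rewrite /= big_seq1 /code_weight /= expr0 !mul1r.
rewrite mulnS add2n -[RHS]/(dyck_sum (2 * m).+1 1 (fun x => phi (false :: x)) + 0 * _).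
rewrite mul0r addr0 dyck_sum_insert big_codesS.
apply: eq_bigr => a _; rewrite -IH mulr_sumr; apply: eq_bigr => c _.
by rewrite /code_weight /= addn0 !exprD; ring.
Qed.

Definition up (f : nat -> R) (h : nat) : R := f h.+1.
(** At height 0 the factor [0] = 0 cancels the value at the truncated [h.-1]. *)
Definition down (f : nat -> R) (h : nat) : R := qnat h * f h.-1.
Definition hop (q : R) (f : nat -> R) (h : nat) : R := up f h + q * down f h.
Definition sign (f : nat -> R) (h : nat) : R := s ^+ h * f h.
Definition ballot (r : nat) : nat -> R := iter r (hop 1) (fun h => (h == 0%N)%:R).

Lemma eq_iter_hop q a f g : f =1 g -> iter a (hop q) f =1 iter a (hop q) g.
Proof. by elim: a => //= a IH E h; rewrite /hop /up /down !IH. Qed.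

Lemma iter_hop_linear q a k f g h :
  iter a (hop q) (fun i => f i + k * g i) h =
  iter a (hop q) f h + k * iter a (hop q) g h.
Proof. by elim: a h => //= a IH h; rewrite /hop /up /down !IH; ring. Qed.

Lemma iter_hop0 q a h : iter a (hop q) (fun=> 0) h = 0.
Proof. by elim: a h => //= a IH h; rewrite /hop /up /down !IH; ring. Qed.

(** With [up_hop], a form of the commutation X Y = p Y X + [sign], which is [h + 1] = s^h + p [h]:
    here T_p Y = [sign] + p Y T_1, there X T_1 = [sign] + T_p X. *)
Lemma hop_down f : hop p (down f) =1 (fun h => sign f h + p * down (hop 1 f) h).
Proof. by case=> [|h]; rewrite /hop /down /up /sign /=; ring. Qed.

Lemma up_hop f : up (hop 1 f) =1 (fun h => sign f h + 1 * hop p (up f) h).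
Proof. by case=> [|h]; rewrite /hop /down /up /sign /=; ring. Qed.

Lemma hop_hop f : hop p f =1 (fun h => hop 1 f h + (p - 1) * down f h).
Proof. by move=> h; rewrite /hop; ring. Qed.

(** A step up or down multiplies s^h by [s] in both cases, because [s] is its own inverse. *)
Lemma hop_sign f : hop p (sign f) =1 (fun h => s * sign (hop p f) h).
Proof.
case=> [|h]; rewrite /hop /down /up /sign /= !exprS ?expr0; first by ring.
rewrite -[X in p * (_ * (X * _))]mul1r -ss; ring.
Qed.

Lemma iter_hop_sign a f h :
  iter a (hop p) (sign f) h = s ^+ a * sign (iter a (hop p) f) h.
Proof.
elim: a f h => [|a IH] f h; first by rewrite mul1r.
rewrite iterSr (eq_iter_hop _ _ (hop_sign f)).
have -> : iter a (hop p) (fun i => s * sign (hop p f) i) h =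
          s * iter a (hop p) (sign (hop p f)) h.
  rewrite -[RHS]add0r -(iter_hop0 p a h) -iter_hop_linear.
  by apply: eq_iter_hop => i; rewrite add0r.
by rewrite IH -iterSr exprS mulrA.
Qed.

(** By [iter_hop_sign] this is s^a times the value at 0 of T_p^a T_1^q delta, so for a + q = 2m it
    is the nesting sum over codes of length m + 1 with head [a]. *)
Let peak a q : R := iter a (hop p) (sign (ballot q)) 0.

(** [hop_down] moves [down] to the left past the operators T_p one at a time. Each exchange leaves a
    peak and a factor [p]; once leftmost, [down] vanishes at height 0. *)
Lemma iter_down r a : (a <= r.+1)%N ->
  iter a (hop p) (down (ballot (r.+1 - a))) 0 =
  \sum_(i < a) p ^+ (a - i.+1) * peak i (r - i).
Proof.
elim: a => [_|a IH lt_a]; first by rewrite big_ord0 /= /down mul0r.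
rewrite subSS iterSr (eq_iter_hop _ _ (hop_down _)) iter_hop_linear.
rewrite -[hop 1 _]/(ballot (r - a).+1) -subSn // IH 1?ltnW //.
rewrite big_ord_recr /= subnn mul1r addrC; congr (_ + _).
rewrite mulr_sumr; apply: eq_bigr => i _.
by rewrite subSS mulrA -exprS -subSn.
Qed.

(** [up_hop] moves [up] to the right through the operators T_1, turning each into T_p and leaving a
    peak. *)
Lemma ballot_up r a : (a <= r.+1)%N ->
  ballot r.+1 1 =
  \sum_(i < a) peak i (r - i) + iter a (hop p) (up (ballot (r.+1 - a))) 0.
Proof.
elim: a => [_|a IH lt_a]; first by rewrite big_ord0 add0r.
rewrite IH 1?ltnW // big_ord_recr /= -addrA; congr (_ + _).
rewrite subSn // -[ballot _.+1]/(hop 1 (ballot (r - a))).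
by rewrite (eq_iter_hop _ _ (up_hop _)) iter_hop_linear mul1r subSS -iterSr.
Qed.

(** The recurrence of walks: the truncated exponent a - (i + 1) is the number of north steps between
    consecutive entries i and a. For a = 0 only peaks remain, since [up] kills delta; replacing one
    T_1 by T_p adds (p - 1) times [iter_down], which multiplies exactly the terms i < a by [p]. *)
Lemma iter_hop_ballot r a : (a <= r.+2)%N ->
  iter a (hop p) (ballot (r.+2 - a)) 0 =
  \sum_(i < r.+1) p ^+ (a - i.+1) * peak i (r - i).
Proof.
elim: a => [_|a IH lt_a].
  rewrite subn0 [LHS](_ : _ = ballot r.+1 1).
    rewrite (ballot_up (leqnn _)) subnn [X in _ + X](_ : _ = 0) ?addr0.
      by apply: eq_bigr => i _; rewrite sub0n mul1r.
    have /(eq_iter_hop p r.+1) -> : up (ballot 0) =1 (fun=> 0) by [].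
    exact: iter_hop0.
  by rewrite -[LHS]/(hop 1 (ballot r.+1) 0) /hop /down mul0r mulr0 addr0.
rewrite subSS iterSr (eq_iter_hop _ _ (hop_hop _)) iter_hop_linear.
rewrite -[hop 1 _]/(ballot (r.+1 - a).+1) -subSn // IH 1?ltnW //.
rewrite iter_down //.
rewrite [X in _ + _ * X](big_ord_widen r.+1 (fun i => p ^+ (a - i.+1) * peak i (r - i))) //.
rewrite [X in _ + _ * X]big_mkcond mulr_sumr -big_split; apply: eq_bigr => i _ /=.
case: ltnP => [lt_i|ge_i].
  by rewrite subSS -[(a - i)%N]prednK ?subn_gt0 // -subnS exprS; ring.
have [-> ->] : (a.+1 - i.+1 = 0 /\ a - i.+1 = 0)%N by split; apply/eqP; rewrite subn_eq0; lia.
by ring.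
Qed.

Lemma dyck_sum1 q h : dyck_sum q h (fun=> 1) = ballot q h.
Proof.
elim: q h => [|q IH] h; first by rewrite /= mulr1.
by rewrite /= !IH /hop /up /down mul1r.
Qed.

Lemma dyck_sum_take a q h :
  dyck_sum (a + q) h (fun x => p ^+ count id (take a x)) =
  iter a (hop p) (ballot q) h.
Proof.
elim: a h => [|a IH] h.
  by rewrite -[RHS]dyck_sum1; apply: eq_dyck_sum => x; rewrite take0.
rewrite addSn iterS /hop /up /down -!IH [LHS]/=; congr (_ + _).
rewrite [RHS]mulrCA; congr (_ * _); rewrite -dyck_sumZ.
by apply: eq_dyck_sum => x; rewrite exprS.
Qed.

Lemma sum_nests m a : (a <= 2 * m)%N ->
  \sum_(c <- codes m) code_weight nests (a :: c) =
  s ^+ a * iter a (hop p) (ballot (2 * m - a)) 0.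
Proof.
move=> le_a; rewrite -dyck_sum_take subnKC // -sum_nests_word mulr_sumr.
by apply: eq_bigr => c _; rewrite /code_weight /= !exprD; ring.
Qed.

(** Both sums obey the same recurrence on the second entry i of the code: for north steps by
    definition, for nestings by [iter_hop_ballot]. *)
Lemma sum_norths m a : (a <= 2 * m)%N ->
  \sum_(c <- codes m) code_weight norths (a :: c) =
  \sum_(c <- codes m) code_weight nests (a :: c).
Proof.
elim: m a => [|m IH] a le_a.
  by move: le_a; rewrite leqn0 => /eqP ->; rewrite !big_seq1.
rewrite sum_nests // mulnS add2n iter_hop_ballot; last by rewrite -add2n -mulnS.
rewrite big_codesS mulr_sumr; apply: eq_bigr => i _.
have le_i : (i <= 2 * m)%N by rewrite -ltnS.
rewrite /peak iter_hop_sign /sign mul1r.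
rewrite -sum_nests // -IH //.
rewrite !mulr_sumr; apply: eq_bigr => c _.
by rewrite /code_weight /= !exprD; ring.
Qed.

End Equidistribution.

(** * Prime codes *)

(** Suffixes of valid codes are valid, so a valid code splits into two smaller valid codes as soon
    as a proper nonempty prefix is valid. *)
Definition prime_code (c : seq nat) : bool :=
  [&& c != [::], valid c & all (fun k => ~~ valid (take k c)) (iota 1 (size c).-1)].

Definition first_factor (c : seq nat) : nat :=
  (find (fun k => valid (take k c)) (iota 1 (size c))).+1.

Fixpoint factors_rec (fuel : nat) (c : seq nat) : seq (seq nat) :=
  if fuel is m.+1 then
    if c is [::] then [::]
    else take (first_factor c) c :: factors_rec m (drop (first_factor c) c)
  else [::].

Definition factors c := factors_rec (size c) c.

Lemma size_code_gt0 (c : seq nat) : c != [::] -> 0 < size c.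
Proof. by case: c. Qed.

Lemma prime_code_valid c : prime_code c -> valid c.
Proof. by case/and3P. Qed.

Lemma prime_code_prefix c1 c2 : prime_code (c1 ++ c2) -> valid c1 -> c1 != [::] -> c2 = [::].
Proof.
case/and3P=> _ _ /allP no_prefix v1 /size_code_gt0 gt0.
apply/eqP; apply: contraLR v1 => /size_code_gt0 gt0'.
have := no_prefix (size c1); rewrite take_size_cat // mem_iota size_cat; apply; lia.
Qed.

Lemma first_factor_prime e c : prime_code e -> first_factor (e ++ c) = size e.
Proof.
case/and3P=> /size_code_gt0 gt0 ve no_prefix.
have -> : first_factor (e ++ c) =
  (find (fun k => valid (take k (e ++ c))) (iota 1 ((size e).-1 + (size c).+1))).+1.
  by rewrite /first_factor size_cat; congr (find _ (iota _ _)).+1; lia.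
rewrite iotaD find_cat ifN.
  rewrite add1n prednK //= take_size_cat // ve size_iota; lia.
rewrite -all_predC; apply/allP => k k_in /=; rewrite takel_cat; last first.
  by move: k_in; rewrite mem_iota; lia.
exact: (allP no_prefix).
Qed.

Lemma first_factorP c : valid c -> c != [::] ->
  prime_code (take (first_factor c) c) /\ first_factor c <= size c.
Proof.
move=> vc /size_code_gt0 gt0.
set P := fun k => valid (take k c).
have hasP : has P (iota 1 (size c)).
  by apply/hasP; exists (size c); [rewrite mem_iota gt0 add1n ltnS leqnn|rewrite /P take_size].
have ff : first_factor c = (find P (iota 1 (size c))).+1 by [].
have P_nth := nth_find 0 hasP; have P_before := @before_find _ 0 P (iota 1 (size c)).
have : find P (iota 1 (size c)) < size c by move: hasP; rewrite has_find size_iota.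
move: (find _ _) ff P_nth P_before => i -> + + lt_i.
rewrite nth_iota // add1n => P_i before_i.
split=> //; apply/and3P; split=> //; first by case: (c) gt0.
rewrite size_takel //; apply/allP=> k; rewrite mem_iota => k_in.
have /before_i : k.-1 < i by lia.
rewrite nth_iota; last by lia.
by rewrite add1n prednK /P; last lia; move=> E; rewrite take_takel ?E //; lia.
Qed.

Lemma factors_recP m c : valid c -> size c <= m ->
  flatten (factors_rec m c) = c /\ all prime_code (factors_rec m c).
Proof.
elim: m c => [|m IH] [|a c] // vc le_sz.
have [pr _] := first_factorP vc isT.
have [||E1 E2] := IH (drop (first_factor (a :: c)) (a :: c)).
- by apply: (@valid_catr (take (first_factor (a :: c)) (a :: c))); rewrite cat_take_drop.
- by rewrite size_drop /first_factor /=; move: le_sz => /=; lia.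
rewrite -[factors_rec _ _]/(take (first_factor (a :: c)) (a :: c) ::
                            factors_rec m (drop (first_factor (a :: c)) (a :: c))).
by split; [rewrite -[flatten _]/(_ ++ flatten _) E1 cat_take_drop|apply/andP].
Qed.

Lemma factorsP c : valid c -> flatten (factors c) = c /\ all prime_code (factors c).
Proof. by move=> vc; apply: factors_recP. Qed.

(** Uniqueness of the prime decomposition: no proper nonempty prefix of a prime code is valid, so
    [first_factor] cuts off exactly the first code of the list. *)
Lemma factors_flatten cs : all prime_code cs -> factors (flatten cs) = cs.
Proof.
rewrite /factors; move: {2 3}(size _) (leqnn (size (flatten cs))) => m.
elim: cs m => [|e cs IH] [|m] //=.
  by rewrite leqn0 size_eq0; case: e => [_ /andP[/and3P[]]|].
rewrite size_cat => le_sz /andP[pr_e pr_cs].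
have e0 : e != [::] by case/and3P: pr_e.
case E: (e ++ flatten cs) => [|a c]; first by case: (e) e0 E.
rewrite -E first_factor_prime // take_size_cat // drop_size_cat // IH //.
by case: (e) e0 le_sz => //= ? ? _; lia.
Qed.

Lemma valid_flatten cs : all prime_code cs -> valid (flatten cs).
Proof. by elim: cs => //= e cs IH /andP[/prime_code_valid ve /IH]; apply: valid_cat. Qed.

Lemma perm_codes_first_factor n (k : 'I_n.+1) :
  perm_eq [seq c <- codes n.+1 | first_factor c == k.+1]
          [seq e ++ c | e <- [seq e <- codes k.+1 | prime_code e], c <- codes (n - k)].
Proof.
apply: uniq_perm.
- exact/filter_uniq/codes_uniq.
- apply: allpairs_uniq; [exact/filter_uniq/codes_uniq|exact: codes_uniq|].
  move=> _ _ /allpairsP[[e c] [+ _ ->]] /allpairsP[[e' c'] [+ _ ->]] /=.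
  rewrite !mem_filter !mem_codes => /and3P[_ _ /eqP sz] /and3P[_ _ /eqP sz'] E.
  by have /eqP := E; rewrite eqseq_cat ?sz // => /andP[/eqP-> /eqP->].
move=> c; apply/idP/allpairsP => [|[[e d] /= [+ + ->]]].
  rewrite mem_filter mem_codes => /and3P[/eqP ff vc /eqP sz].
  have [|pr _] := first_factorP vc; first by case: (c) sz.
  exists (take k.+1 c, drop k.+1 c); rewrite /= cat_take_drop; split=> //.
    rewrite -ff mem_filter pr mem_codes (prime_code_valid pr) size_takel ?eqxx ?ff //.
    by rewrite sz.
  rewrite mem_codes size_drop sz subSS eqxx andbT.
  by apply: (@valid_catr (take k.+1 c)); rewrite cat_take_drop.
rewrite !mem_filter !mem_codes => /and3P[pr ve /eqP sze] /andP[vd /eqP szd].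
rewrite first_factor_prime // valid_cat // size_cat sze szd eqxx /=.
by apply/eqP; case: k {pr ve sze szd} => k /=; lia.
Qed.

Lemma sum_codes_first_factor (V : nmodType) n (F : seq nat -> V) :
  (\sum_(c <- codes n.+1) F c =
   \sum_(k < n.+1) \sum_(e <- codes k.+1 | prime_code e)
     \sum_(c <- codes (n - k)) F (e ++ c))%R.
Proof.
transitivity (\sum_(k < n.+1) \sum_(c <- codes n.+1 | first_factor c == k.+1) F c)%R.
  under [RHS]eq_bigr do rewrite big_mkcond.
  rewrite exchange_big; rewrite [LHS]big_seq [RHS]big_seq; apply: eq_bigr => c.
  rewrite mem_codes => /andP[vc /eqP sz].
  have [|_] := first_factorP vc; first by case: (c) sz.
  rewrite sz => le_ff; rewrite -big_mkcond /= (big_pred1 (Ordinal le_ff)) //.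
apply: eq_bigr => k _; rewrite -big_filter (perm_big _ (perm_codes_first_factor k)).
by rewrite big_allpairs_dep big_filter.
Qed.

(** * Equidistribution over prime codes *)

Section PrimeEquidistribution.
Local Open Scope ring_scope.
Variables (R : comNzRingType) (p s : R).
Hypothesis ss : s * s = 1.

Local Notation weight := (code_weight p s).

Lemma weight_cat (f : seq nat -> nat) c1 c2 : f (c1 ++ c2) = (f c1 + f c2)%N ->
  weight f (c1 ++ c2) = weight f c1 * weight f c2.
Proof. by rewrite /code_weight => ->; rewrite sumn_cat !exprD; ring. Qed.

Lemma sum_codes_norths_nests n :
  \sum_(c <- codes n) weight norths c = \sum_(c <- codes n) weight nests c.
Proof.
case: n => [|n]; first by rewrite !big_seq1.
by rewrite !big_codesS; apply: eq_bigr => a _; rewrite sum_norths // -ltnS.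
Qed.

Lemma sum_head_norths_nests n a :
  \sum_(c <- codes n.+1 | head 0%N c == a) weight norths c =
  \sum_(c <- codes n.+1 | head 0%N c == a) weight nests c.
Proof.
rewrite big_mkcond [RHS]big_mkcond !big_codesS /=; apply: eq_bigr => b _.
by case: eqP => _; rewrite ?big1_eq // sum_norths // -ltnS.
Qed.

Lemma sum_primes_head f n a :
  (forall c1 c2, valid c1 -> f (c1 ++ c2) = (f c1 + f c2)%N) ->
  \sum_(c <- codes n.+1 | head 0%N c == a) weight f c =
  \sum_(k < n.+1)
    (\sum_(e <- codes k.+1 | prime_code e && (head 0%N e == a)) weight f e) *
    \sum_(c <- codes (n - k)) weight f c.
Proof.
move=> f_cat; rewrite big_mkcond sum_codes_first_factor; apply: eq_bigr => k _.
rewrite [X in _ = X * _]big_mkcondr mulr_suml [LHS]big_seq_cond [RHS]big_seq_cond.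
apply: eq_bigr => e.
rewrite mem_codes => /andP[/andP[ve _] /and3P[e0 _ _]].

rewrite mulr_sumr; case: (e) e0 ve => // b d _ ve /=.
case: eqP => _; last by rewrite big1 // big1 // => c _; rewrite mul0r.
by apply: eq_bigr => c _; rewrite -weight_cat ?f_cat.
Qed.

(** Strong induction on the decomposition by first factor. The term k = n, with trivial cofactor, is
    the sum over prime codes; all other terms agree by induction and by equidistribution over all
    codes, and cancel. *)
Lemma sum_primes_norths_nests n a :
  \sum_(e <- codes n.+1 | prime_code e && (head 0%N e == a)) weight norths e =
  \sum_(e <- codes n.+1 | prime_code e && (head 0%N e == a)) weight nests e.
Proof.
elim/ltn_ind: n => n IH; have := sum_head_norths_nests n a.
rewrite (sum_primes_head _ _ norths_cat) (sum_primes_head _ _ nests_cat).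
rewrite !big_ord_recr /= subnn !big_seq1 /code_weight /= !mulr1.
under eq_bigr => k _ do rewrite (IH k) // sum_codes_norths_nests.
by move/addrI.
Qed.

End PrimeEquidistribution.

(* [e] is 1 or -1; the two values together separate the parities of [sumn c]. *)
Lemma sum_primes_sign (e : int) n a N : (e * e = 1)%R ->
  (\sum_(c <- codes n | [&& prime_code c, head 0%N c == a & norths c == N]) e ^+ sumn c =
   \sum_(c <- codes n | [&& prime_code c, head 0%N c == a & nests c == N]) e ^+ sumn c)%R.
Proof.
move=> ee; case: n => [|n]; first by rewrite !big_cons !big_nil.
(* Over integer polynomials, with [p] the indeterminate and [s] the constant [e], the coefficient of
   degree [N] selects the codes with statistic [N]. *)
have ss : (e%:P * e%:P = 1 :> {poly int})%R by rewrite -polyCM ee.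
have coefE f : (\sum_(c <- codes n.+1 | [&& prime_code c, head 0%N c == a & f c == N]) e ^+ sumn c =
    (\sum_(c <- codes n.+1 | prime_code c && (head 0%N c == a)) code_weight 'X e%:P f c)`_N)%R.
  rewrite coef_sum; under eq_bigl => c do rewrite andbA.
  rewrite big_mkcondr; apply: eq_bigr => c _.
  rewrite /code_weight -polyC_exp mulrC coefCM coefXn [_ == N]eq_sym.
  by case: eqP; rewrite ?mulr1 ?mulr0.
by rewrite !coefE (sum_primes_norths_nests _ ss).
Qed.

Definition stat (f : seq nat -> nat) (c : seq nat) : nat * bool * nat :=
  (f c, odd (sumn c), head 0 c).

(** The parity [b] is detected by 1 + (-1)^b (-1)^k, which is 2 if k has parity [b] and 0 otherwise;
    hence the factor 2 and the two signs. *)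
Lemma count_primes_stat n v :
  count (fun c => stat norths c == v) [seq c <- codes n | prime_code c] =
  count (fun c => stat nests c == v) [seq c <- codes n | prime_code c].
Proof.
case: v => [[N b] a]; apply/eqP; rewrite -(eqr_nat int) -(inj_eq (mulfI (isT : (2 != 0 :> int)%R))).
pose primes_with f c := [&& prime_code c, head 0 c == a & f c == N].
have countE f :
  (2 * (count (fun c => stat f c == (N, b, a)) [seq c <- codes n | prime_code c])%:R =
   \sum_(c <- codes n | primes_with f c) 1 ^+ sumn c +
   (-1) ^+ b * \sum_(c <- codes n | primes_with f c) (-1) ^+ sumn c :> int)%R.
  rewrite -sum1_count natr_sum big_filter_cond !mulr_sumr -big_split /=.
  rewrite big_mkcond [RHS]big_mkcond; apply: eq_bigr => c _.
  rewrite /primes_with /stat !xpair_eqE -[((-1) ^+ sumn c)%R]signr_odd expr1n.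
  case: (prime_code c) (f c == N) (head 0 c == a) => [] [] [] /=; rewrite ?andbF ?andbT //.
  by case: b (odd (sumn c)) => [] [].
by rewrite !countE !sum_primes_sign.
Qed.

(** * A bijection of codes transporting the statistics *)

Section MatchStat.
Variables (T : eqType) (S : eqType) (x0 : T) (f g : T -> S) (r : seq T).
Hypothesis uniq_r : uniq r.
Hypothesis count_fg : forall v, count (fun x => f x == v) r = count (fun x => g x == v) r.

(* The i-th element of [r] with [f]-value [v] is sent to the i-th element of [r]
   with [g]-value [v]. *)
Definition match_stat (x : T) : T :=
  nth x0 [seq y <- r | g y == f x] (index x [seq y <- r | f y == f x]).

Lemma match_stat_index x : x \in r ->
  index x [seq y <- r | f y == f x] < size [seq y <- r | g y == f x].
Proof.
move=> xr; rewrite size_filter -count_fg -size_filter index_mem.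
by rewrite mem_filter eqxx.
Qed.

Lemma match_statP x : x \in r -> (match_stat x \in r) /\ g (match_stat x) = f x.
Proof.
move=> xr; have := mem_nth x0 (match_stat_index xr).
by rewrite mem_filter => /andP[/eqP].
Qed.

Lemma match_stat_inj : {in r &, injective match_stat}.
Proof.
move=> x y xr yr E; have Ef : f x = f y.
  by rewrite -(match_statP xr).2 E (match_statP yr).2.
have lt_x := match_stat_index xr; have lt_y := match_stat_index yr.
rewrite -Ef in lt_y.
move/eqP: E; rewrite /match_stat -Ef nth_uniq ?filter_uniq // => /eqP.
have x_in : x \in [seq z <- r | f z == f x] by rewrite mem_filter eqxx.
have y_in : y \in [seq z <- r | f z == f x] by rewrite mem_filter Ef eqxx.
by move=> E; rewrite -(nth_index x0 x_in) E nth_index.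
Qed.

End MatchStat.

Definition prime_bijection (e : seq nat) : seq nat :=
  match_stat [::] (stat norths) (stat nests)
    [seq c <- codes (size e) | prime_code c] e.

Lemma prime_bijectionP e : prime_code e ->
  [/\ prime_code (prime_bijection e),
      size (prime_bijection e) = size e &
      stat nests (prime_bijection e) = stat norths e].
Proof.
move=> pr; have e_in : e \in [seq c <- codes (size e) | prime_code c].
  by rewrite mem_filter pr mem_codes prime_code_valid ?eqxx.
have [] := match_statP [::] (count_primes_stat (size e)) e_in.
by rewrite mem_filter mem_codes => /and3P[-> _ /eqP ->].
Qed.

Lemma prime_bijection_inj : {in prime_code &, injective prime_bijection}.
Proof.
move=> c e pr_c pr_e E; have [_ sz_c _] := prime_bijectionP pr_c.
have [_ sz_e _] := prime_bijectionP pr_e.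
have sz : size c = size e by rewrite -sz_c E.
have c_in : c \in [seq c <- codes (size c) | prime_code c].
  by rewrite mem_filter [prime_code c]pr_c mem_codes prime_code_valid ?eqxx.
have e_in : e \in [seq c <- codes (size c) | prime_code c].
  by rewrite mem_filter [prime_code e]pr_e mem_codes prime_code_valid // sz eqxx.
apply: (match_stat_inj (x0 := [::]) _ (count_primes_stat (size c)) c_in e_in).
  exact/filter_uniq/codes_uniq.
by move: E; rewrite /prime_bijection -sz.
Qed.

Definition code_bijection (c : seq nat) : seq nat :=
  flatten (map prime_bijection (factors c)).

Lemma all_prime_bijection cs : all prime_code cs -> all prime_code (map prime_bijection cs).
Proof.
move=> /allP pr; rewrite all_map; apply/allP => c /pr pr_c /=.
by have [] := prime_bijectionP pr_c.
Qed.

Lemma code_bijection_flatten cs : all prime_code cs ->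
  code_bijection (flatten cs) = flatten (map prime_bijection cs).
Proof. by rewrite /code_bijection => pr; rewrite factors_flatten. Qed.

Lemma code_bijection_prime e : prime_code e ->
  code_bijection e = prime_bijection e.
Proof.
move=> pr; rewrite -[e in LHS](cats0 e) -[e ++ _]/(flatten [:: e]).
by rewrite code_bijection_flatten /= ?cats0 ?pr.
Qed.

(** North steps, nestings and the sum are additive over factors, while the head is that of the first
    factor, which is nonempty on both sides. *)
Lemma code_bijectionP c : valid c ->
  [/\ valid (code_bijection c),
      size (code_bijection c) = size c &
      stat nests (code_bijection c) = stat norths c].
Proof.
move=> /factorsP[E pr]; rewrite -[c in _ = size c]E -[c in _ = stat norths c]E.
rewrite /code_bijection; move: (factors c) pr => {E c}.
elim=> //= e cs IH /andP[pr_e pr_cs]; have [v1 sz1 st1] := IH pr_cs.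
have [pr2 sz2 st2] := prime_bijectionP pr_e.
have v2 := prime_code_valid pr2; have ve := prime_code_valid pr_e.
split; [exact: valid_cat|by rewrite !size_cat sz1 sz2|].
move: st1 st2 => [Ef Eo _] [Ef' Eo' Eh'].
rewrite /stat nests_cat // norths_cat // !sumn_cat !oddD Ef Ef' Eo Eo'.
congr (_, _, _); case/and3P: pr_e => e0 _ _; case/and3P: pr2 => e0' _ _.
by case: (e) (prime_bijection e) e0 e0' Eh' => [|? ?] [|? ?].
Qed.

Lemma code_bijection_inj : {in valid &, injective code_bijection}.
Proof.
move=> c d /factorsP[Ec pr_c] /factorsP[Ed pr_d] E; rewrite -Ec -Ed; congr flatten.
have := factors_flatten (all_prime_bijection pr_c).
rewrite -/(code_bijection c) E factors_flatten; last exact: all_prime_bijection.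
move: (factors c) (factors d) pr_c pr_d {Ec Ed E}.
elim=> [|a cs IH] [|b ds] //= /andP[pr_a pr_cs] /andP[pr_b pr_ds] [/esym Eab /IH ->] //.
by rewrite (prime_bijection_inj pr_a pr_b Eab).
Qed.

(** An injective map of the finite set of codes of a given size to itself is onto. *)
Lemma code_bijection_surj d : valid d -> exists2 c, valid c & code_bijection c = d.
Proof.
move=> vd; pose n := size d.
have uniq_im : uniq (map code_bijection (codes n)).
  rewrite map_inj_in_uniq ?codes_uniq // => a b.
  by rewrite !mem_codes => /andP[va _] /andP[vb _]; apply: code_bijection_inj.
have sub_im : {subset map code_bijection (codes n) <= codes n}.
  move=> _ /mapP[c + ->]; rewrite !mem_codes => /andP[vc /eqP <-].
  by have [-> -> _] := code_bijectionP vc; rewrite eqxx.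
have [_ eq_im] := uniq_min_size uniq_im sub_im (eq_leq (esym (size_map _ _))).
have : d \in map code_bijection (codes n) by rewrite eq_im mem_codes vd eqxx.
by case/mapP=> c; rewrite mem_codes => /andP[vc _] ->; exists c.
Qed.

(** * Walks *)

(* The equality test on steps goes through [inord] and does not compute. *)
Lemma step_eqE (s t : Defs.step) : (s == t) =
  match s, t with
  | East, East | North, North | South, South => true
  | _, _ => false
  end.
Proof. by case: s t => [] []; apply/eqP. Qed.

Definition vertical (u t : nat) : walk := nseq (t - u) North ++ nseq (u - t) South.

(** The walk whose east steps have the heights in [c] above y = -x and which ends at height [t];
    [a.+1] is the height just after the east step at height [a]. *)
Fixpoint walk_to (t : nat) (c : seq nat) : walk :=
  if c is a :: c' then walk_to a c' ++ East :: vertical a.+1 t else [::].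

Definition walk_of : seq nat -> walk := walk_to 0.

Definition code_of (w : walk) : seq nat :=
  rev [seq absz (e.1 + e.2)%R | e <- east_steps origin w].

(* The point of column [x] at height [d] above the line y = -x. *)
Definition diag_point (x d : nat) : point := (Posz x, (Posz d - Posz x)%R).

Fixpoint east_points (k : nat) (c : seq nat) : seq point :=
  if c is a :: c' then rcons (east_points k c') (diag_point (size c' + k) a) else [::].

Lemma diag_point_origin : origin = diag_point 0 0.
Proof. by []. Qed.

Lemma move_East x d : move (diag_point x d) East = diag_point x.+1 d.+1.
Proof. by congr (_, _); rewrite /=; lia. Qed.

Lemma move_North x d : move (diag_point x d) North = diag_point x d.+1.
Proof. by congr (_, _); rewrite /=; lia. Qed.

Lemma move_South x d : move (diag_point x d.+1) South = diag_point x d.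
Proof. by congr (_, _); rewrite /=; lia. Qed.

Lemma in_wedge_diag_point x d : in_wedge (diag_point x d) = (d <= 2 * x).
Proof. by rewrite /in_wedge /=; apply/idP/idP; lia. Qed.

Lemma on_antidiagonal_diag_point x d : on_antidiagonal (diag_point x d) = (d == 0).
Proof. by rewrite /on_antidiagonal /=; apply/idP/idP; lia. Qed.

Lemma endpoint_cat p w1 w2 : endpoint p (w1 ++ w2) = endpoint (endpoint p w1) w2.
Proof. exact: foldl_cat. Qed.

Lemma east_steps_cat p w1 w2 :
  east_steps p (w1 ++ w2) = east_steps p w1 ++ east_steps (endpoint p w1) w2.
Proof. by elim: w1 p => [|[] w1 IH] p //=; rewrite IH. Qed.

Lemma endpoint_North k x d : endpoint (diag_point x d) (nseq k North) = diag_point x (d + k).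
Proof.
elim: k d => [|k IH] d; first by rewrite addn0.
by rewrite -[LHS]/(endpoint (move _ North) (nseq k North)) move_North IH addSnnS.
Qed.

Lemma endpoint_South k x d :
  endpoint (diag_point x (d + k)) (nseq k South) = diag_point x d.
Proof.
elim: k => [|k IH]; first by rewrite addn0.
by rewrite -[LHS]/(endpoint (move _ South) (nseq k South)) addnS move_South IH.
Qed.

Lemma endpoint_vertical x u t :
  endpoint (diag_point x u) (vertical u t) = diag_point x t.
Proof.
rewrite endpoint_cat endpoint_North.
have -> : u + (t - u) = t + (u - t) by lia.
exact: endpoint_South.
Qed.

Lemma east_steps_vertical p u t : east_steps p (vertical u t) = [::].
Proof.
have steps_nseq k s q : s <> East -> east_steps q (nseq k s) = [::].
  by elim: k q => // k IH q sE; case: s sE IH => // sE IH; apply: IH.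
by rewrite east_steps_cat !steps_nseq.
Qed.

(** [valid (t :: c)] places the final height inside the wedge, and forces [t = 0] when [c] is empty
    and the walk has no steps. *)
Lemma endpoint_walk_to k t c : valid (t :: c) ->
  endpoint (diag_point k 0) (walk_to t c) = diag_point (size c + k) t.
Proof.
elim: c t => [|a c IH] t /andP[].
  by rewrite /= muln0 leqn0 => /eqP ->.
move=> _ vc; rewrite [walk_to _ _]/= endpoint_cat IH //.
by rewrite -[LHS]/(endpoint (move _ East) _) move_East endpoint_vertical.
Qed.

Lemma east_steps_walk_to k t c : valid (t :: c) ->
  east_steps (diag_point k 0) (walk_to t c) = east_points k c.
Proof.
elim: c t => [|a c IH] t // /andP[_ vc].
rewrite [walk_to _ _]/= east_steps_cat IH // endpoint_walk_to //.
by rewrite -[east_steps _ (East :: _)]/(_ :: east_steps _ (vertical _ _)) east_steps_vertical cats1.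
Qed.

Lemma east_points_cat k c1 c2 :
  east_points k (c2 ++ c1) = east_points k c1 ++ east_points (size c1 + k) c2.
Proof.
elim: c2 => [|a c2 IH] /=; first by rewrite cats0.
by rewrite IH rcons_cat size_cat addnA.
Qed.

Lemma code_of_walk_to t c : valid (t :: c) -> code_of (walk_to t c) = c.
Proof.
rewrite /code_of diag_point_origin => /east_steps_walk_to ->.
elim: c => //= a c IH; rewrite map_rcons rev_rcons IH /=; congr (_ :: _); lia.
Qed.

Lemma code_of_walk_of c : valid c -> code_of (walk_of c) = c.
Proof. by move=> vc; apply: (@code_of_walk_to 0). Qed.

Lemma walk_of_inj : {in valid &, injective walk_of}.
Proof. by move=> c d vc vd E; rewrite -(code_of_walk_of vc) E code_of_walk_of. Qed.

Lemma count_East_vertical u t : count_mem East (vertical u t) = 0.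
Proof. by rewrite count_cat !count_nseq /= !step_eqE. Qed.

Lemma count_East_walk_to t c : count_mem East (walk_to t c) = size c.
Proof.
elim: c t => //= a c IH t.
by rewrite count_cat IH /= count_East_vertical eqxx addn1.
Qed.

(** Codes run backwards along the walk, so concatenation is reversed. *)
Lemma walk_to_cat t c1 c2 : valid (t :: c2) ->
  walk_to t (c2 ++ c1) = walk_of c1 ++ walk_to t c2.
Proof.
elim: c2 t => [|a c2 IH] t /andP[].
  by rewrite /= muln0 leqn0 => /eqP -> _; rewrite cats0.
by move=> _ vc; rewrite /= IH // catA.
Qed.

Lemma walk_of_cat c1 c2 : valid c2 -> walk_of (c2 ++ c1) = walk_of c1 ++ walk_of c2.
Proof. by move=> vc; apply: (@walk_to_cat 0). Qed.

Lemma north_steps_walk_to t c : valid (t :: c) -> north_steps (walk_to t c) = norths (t :: c).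
Proof.
elim: c t => [|a c IH] t /andP[].
  by rewrite /= muln0 leqn0 => /eqP ->.
move=> _ vc; rewrite /north_steps /= count_cat -/(north_steps _) IH //= step_eqE add0n.
by rewrite count_cat !count_nseq /= !step_eqE; lia.
Qed.

Lemma last_descent_walk_of a c : last_descent (walk_of (a :: c)) = a.+1.
Proof.
rewrite /last_descent /walk_of /= rev_cat rev_cons -cats1 -catA /=.
have notin : East \notin rev (vertical a.+1 0).
  by rewrite mem_rev -has_pred1 has_count count_East_vertical.
rewrite index_cat (negbTE notin) /= eqxx addn0 take_size_cat //.
rewrite count_rev count_cat !count_nseq /= !step_eqE.
by lia.
Qed.

Lemma oppositeE s t : opposite s t =
  match s, t with North, South | South, North => true | _, _ => false end.
Proof. by rewrite /opposite !step_eqE; case: s t => [] []. Qed.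

Lemma partially_directed_East w v :
  partially_directed (w ++ East :: v) = partially_directed w && partially_directed v.
Proof.
rewrite /partially_directed.
have path_East u : path (fun s t => ~~ opposite s t) East u = sorted (fun s t => ~~ opposite s t) u.
  by case: u => //= s u; rewrite oppositeE.
case: w => [|s w] /=; first exact: path_East.
rewrite cat_path /= path_East; congr (_ && _).
by rewrite oppositeE; case: (last s w).
Qed.

Lemma partially_directed_vertical u t : partially_directed (vertical u t).
Proof.
have pd k s : partially_directed (nseq k s).
  by case: k => //= k; elim: k => //= k ->; rewrite oppositeE; case: s.
rewrite /vertical; case: (leqP t u) => [/eqP -> | /ltnW/eqP ->]; first exact: pd.
by rewrite cats0; apply: pd.
Qed.

Lemma partially_directed_walk_to t c : partially_directed (walk_to t c).
Proof.
elim: c t => //= a c IH t.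
by rewrite partially_directed_East IH partially_directed_vertical.
Qed.

Lemma partially_directed_catl w1 w2 : partially_directed (w1 ++ w2) -> partially_directed w1.
Proof. by case: w1 => //= s w1; rewrite /partially_directed /= cat_path => /andP[]. Qed.

Definition stays_in_wedge (p : point) (w : walk) : bool := all in_wedge (points p w).

Lemma stays_in_wedge_cons p s w :
  stays_in_wedge p (s :: w) = in_wedge p && stays_in_wedge (move p s) w.
Proof. by []. Qed.

Lemma stays_in_wedge_cat p w1 w2 :
  stays_in_wedge p (w1 ++ w2) = stays_in_wedge p w1 && stays_in_wedge (endpoint p w1) w2.
Proof.
elim: w1 p => [|s w1 IH] p.
  rewrite cat0s /stays_in_wedge /=; by case: (in_wedge p).
by rewrite cat_cons !stays_in_wedge_cons IH andbA.
Qed.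

Lemma stays_in_wedge_North k x d : d + k <= 2 * x ->
  stays_in_wedge (diag_point x d) (nseq k North).
Proof.
elim: k d => [|k IH] d le_d.
  by rewrite /stays_in_wedge /= in_wedge_diag_point -(addn0 d) le_d.
rewrite stays_in_wedge_cons move_North IH ?in_wedge_diag_point; lia.
Qed.

Lemma stays_in_wedge_South k x d : d + k <= 2 * x ->
  stays_in_wedge (diag_point x (d + k)) (nseq k South).
Proof.
elim: k => [|k IH] le_d; first by rewrite /stays_in_wedge /= in_wedge_diag_point le_d.
rewrite stays_in_wedge_cons in_wedge_diag_point le_d addnS move_South IH //; lia.
Qed.

Lemma stays_in_wedge_vertical x u t : u <= 2 * x -> t <= 2 * x ->
  stays_in_wedge (diag_point x u) (vertical u t).
Proof.
move=> le_u le_t; rewrite stays_in_wedge_cat stays_in_wedge_North; last by lia.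
rewrite endpoint_North; have -> : u + (t - u) = t + (u - t) by lia.
by apply: stays_in_wedge_South; lia.
Qed.

Lemma stays_in_wedge_walk_to t c : valid (t :: c) -> stays_in_wedge origin (walk_to t c).
Proof.
elim: c t => [|a c IH] t // /andP[le_t vc].
rewrite [walk_to _ _]/= stays_in_wedge_cat IH // diag_point_origin endpoint_walk_to //.
rewrite stays_in_wedge_cons move_East addn0 in_wedge_diag_point; case/andP: vc => le_a _.
by rewrite le_a stays_in_wedge_vertical //; lia.
Qed.

Lemma pdsaw_walk_of c : valid c -> pdsaw (size c) (walk_of c).
Proof.
move=> vc; apply/and4P; split.
- exact: partially_directed_walk_to.
- exact: stays_in_wedge_walk_to.
- by rewrite diag_point_origin endpoint_walk_to // on_antidiagonal_diag_point.
- by rewrite count_East_walk_to.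
Qed.

Lemma nseqSr (T : Type) k (x : T) : nseq k.+1 x = rcons (nseq k x) x.
Proof. by rewrite -cats1 -[[:: x]]/(nseq 1 x) -nseqD addn1. Qed.

Lemma vertical_North u t : u <= t -> vertical u t.+1 = rcons (vertical u t) North.
Proof.
move=> le_ut; rewrite /vertical subSn //.
have -> : u - t.+1 = 0 by lia.
have -> : u - t = 0 by lia.
by rewrite !cats0 nseqSr.
Qed.

Lemma vertical_South u t : t < u -> vertical u t = rcons (vertical u t.+1) South.
Proof.
move=> lt_tu; rewrite /vertical -(@subnSK t u) // nseqSr -rcons_cat.
by have [-> ->] : t - u = 0 /\ t.+1 - u = 0 by split; lia.
Qed.

Lemma walk_to_North t a c : a.+1 <= t ->
  walk_to t.+1 (a :: c) = rcons (walk_to t (a :: c)) North.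
Proof. by move=> le_t; rewrite /= vertical_North // -rcons_cons rcons_cat. Qed.

Lemma walk_to_South t a c : t < a.+1 ->
  walk_to t (a :: c) = rcons (walk_to t.+1 (a :: c)) South.
Proof. by move=> lt_t; rewrite /= vertical_South // -rcons_cons rcons_cat. Qed.

Lemma partially_directed_rcons2 w s t :
  partially_directed (rcons (rcons w s) t) -> ~~ opposite s t.
Proof.
rewrite -!cats1 -catA; case: w => [|x w]; first by case/andP.
by rewrite /partially_directed /= cat_path /= => /and4P[].
Qed.

(** Induction on the last step. East turns the final height [t] into a new entry of the code; a
    vertical step only changes [t], because reversing the current vertical run is forbidden. *)
Lemma walk_toP w : partially_directed w -> stays_in_wedge origin w ->
  exists t c, valid (t :: c) /\ w = walk_to t c.
Proof.
elim/last_ind: w => [|w s IH]; first by exists 0, [::].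
move=> pd; rewrite -cats1 stays_in_wedge_cat => /andP[/IH].
case=> [|t [c [vtc Ew]]]; first by move: pd; rewrite -cats1 => /partially_directed_catl.
rewrite diag_point_origin Ew endpoint_walk_to // stays_in_wedge_cons => /andP[_].
rewrite /stays_in_wedge /= andbT addn0; rewrite {w IH}Ew cats1 in pd *.
have vc : valid c by case/andP: vtc.
case: s pd => pd.
- exists t.+1, (t :: c); split; last by rewrite /= /vertical subnn cats1.
  by apply/andP; split=> //; case/andP: vtc => le_t _ /=; lia.
- rewrite -/(move (diag_point _ _) North) move_North in_wedge_diag_point => le_t.
  exists t.+1, c; split; first by rewrite /= le_t.
  case: c le_t pd {vtc vc} => [|a c] // le_t pd.
  case: (leqP a.+1 t) => [/walk_to_North->|/walk_to_South E] //.
  by move: pd; rewrite E => /partially_directed_rcons2; rewrite oppositeE.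
rewrite -/(move (diag_point _ _) South).
case: t vtc pd => [|t] vtc pd; first by rewrite /in_wedge /=; lia.
rewrite move_South in_wedge_diag_point => le_t.
exists t, c; split; first by rewrite /= le_t.
case: c le_t pd vtc {vc} => [|a c] // le_t pd vtc.
case: (leqP a.+1 t) => [/walk_to_North E|/walk_to_South ->] //.
by move: pd; rewrite E => /partially_directed_rcons2; rewrite oppositeE.
Qed.

Lemma walk_ofP w : partially_directed w -> stays_in_wedge origin w ->
  on_antidiagonal (endpoint origin w) -> exists2 c, valid c & w = walk_of c.
Proof.
move=> pd wedge; have [t [c [vtc ->]]] := walk_toP pd wedge.
rewrite diag_point_origin endpoint_walk_to // on_antidiagonal_diag_point => /eqP Et.
by exists c; rewrite ?Et //; case/andP: vtc.
Qed.

Lemma pdsawP n w : pdsaw n w -> exists c, [/\ valid c, size c = n & w = walk_of c].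
Proof.
case/and4P=> pd wedge anti /eqP <-; have [c vc ->] := walk_ofP pd wedge anti.
by exists c; rewrite count_East_walk_to.
Qed.

(** In column k + j a point at height a above y = -x is weakly below y = x - 2k iff a <= 2j. This
    makes the factor condition the validity of the corresponding piece of code. *)
Lemma weakly_below_east_points k d c :
  all (weakly_below_from (diag_point k d)) (east_points k c) = valid c.
Proof.
elim: c => //= a c IH; rewrite all_rcons IH; congr (_ && _).
by rewrite /weakly_below_from /=; apply/idP/idP; lia.
Qed.

Lemma endpoint_walk_of k c : valid c ->
  endpoint (diag_point k 0) (walk_of c) = diag_point (size c + k) 0.
Proof. by move=> vc; apply: endpoint_walk_to. Qed.

Lemma east_steps_walk_of k c : valid c ->
  east_steps (diag_point k 0) (walk_of c) = east_points k c.
Proof. by move=> vc; apply: (@east_steps_walk_to k 0). Qed.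

(** [pre] is again a walk in the wedge ending on y = -x, hence has a code; the heights of the east
    steps of [post] form a code, valid by the condition on the line of slope 1. *)
Lemma walk_of_cut c pre post : valid c -> pre ++ post = walk_of c ->
  on_antidiagonal (endpoint origin pre) ->
  all (weakly_below_from (endpoint origin pre)) (east_steps (endpoint origin pre) post) ->
  exists c1 c2, [/\ valid c1, valid c2, c = c2 ++ c1, pre = walk_of c1 & post = walk_of c2].
Proof.
move=> vc E anti.
have [c1 v1 Epre] : exists2 c1, valid c1 & pre = walk_of c1.
  apply: walk_ofP => //.
    by apply: (@partially_directed_catl pre post); rewrite E partially_directed_walk_to.
  have := stays_in_wedge_walk_to (vc : valid (0 :: c)).
  by rewrite -[walk_to 0 c]E stays_in_wedge_cat => /andP[].
rewrite Epre diag_point_origin endpoint_walk_of // addn0 => below.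
pose c2 := rev [seq absz (e.1 + e.2)%R | e <- east_steps (diag_point (size c1) 0) post].
have Ec : c = c2 ++ c1.
  rewrite -(code_of_walk_of vc) -E Epre /code_of east_steps_cat map_cat rev_cat.
  by rewrite -/(code_of _) code_of_walk_of // diag_point_origin endpoint_walk_of // addn0.
have Ees : east_steps (diag_point (size c1) 0) post = east_points (size c1) c2.
  have := congr1 (east_steps (diag_point 0 0)) E.
  rewrite Epre east_steps_cat !east_steps_walk_of // endpoint_walk_of // addn0 Ec.
  rewrite east_points_cat addn0.
  by move/eqP; rewrite eqseq_cat // => /andP[_ /eqP].
have v2 : valid c2 by rewrite -(weakly_below_east_points (size c1) 0) -Ees.
exists c1, c2; split=> //.
by move: E; rewrite Ec walk_of_cat // Epre => /eqP; rewrite eqseq_cat // eqxx => /eqP.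
Qed.

Lemma walk_factor_walk_of c1 c2 c3 : valid c1 -> valid c2 -> valid c3 -> c2 != [::] ->
  walk_factor (walk_of c1) (walk_of c2) (walk_of c3).
Proof.
move=> v1 v2 v3 /size_code_gt0 gt0; rewrite /walk_factor diag_point_origin.
rewrite !endpoint_walk_of // !on_antidiagonal_diag_point /= -walk_of_cat //.
rewrite !east_steps_walk_of ?valid_cat // !weakly_below_east_points valid_cat // v3.
by lia.
Qed.

Lemma walk_factorP c pre u post : valid c -> pre ++ u ++ post = walk_of c ->
  walk_factor pre u post ->
  exists c1 c2 c3, [/\ valid c1, valid c2, valid c3, c2 != [::] &
    [/\ pre = walk_of c1, u = walk_of c2 & post = walk_of c3]].
Proof.
move=> vc E /and5P[antip antiq lt_pq below_p below_q].
rewrite -endpoint_cat in antiq lt_pq below_q.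
have [c1' [c3 [v1' v3 _ Eprefix Epost]]] :=
  walk_of_cut vc (etrans (esym (catA _ _ _)) E) antiq below_q.
have below_u : all (weakly_below_from (endpoint origin pre)) (east_steps (endpoint origin pre) u).
  by move: below_p; rewrite east_steps_cat all_cat => /andP[].
have [c1 [c2 [v1 v2 _ Epre Eu]]] := walk_of_cut v1' Eprefix antip below_u.
exists c1, c2, c3; split=> //; apply: contraTneq lt_pq => c20.
by rewrite Eu c20 cats0 ltxx.
Qed.

Lemma prime_walk_factorP c pre u post : valid c -> pre ++ u ++ post = walk_of c ->
  prime_walk_factor pre u post -> exists2 e, prime_code e & u = walk_of e.
Proof.
move=> vc E [fac prime_u].
have [c1 [e [c3 [v1 ve v3 e0 [Epre Eu Epost]]]]] := walk_factorP vc E fac.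
exists e => //; apply/and3P; split=> //; apply/allP => k; rewrite mem_iota => k_in.
apply/negP => vk; have vd : valid (drop k e).
  by apply: (@valid_catr (take k e)); rewrite cat_take_drop.
(* A valid proper prefix of [e] codes the end of the walk [u], so the remaining suffix codes a
   strictly smaller factor at its start. *)
have Eu2 : u = [::] ++ walk_of (drop k e) ++ walk_of (take k e).
  by rewrite -walk_of_cat // cat_take_drop.
have := prime_u _ _ _ Eu2; rewrite cats0 Epre Epost -walk_of_cat // => /(_ _).
have d0 : drop k e != [::] by apply/eqP => /(congr1 size); rewrite size_drop /=; lia.
move/(_ (walk_factor_walk_of v1 vd (valid_cat v3 vk) d0)).
rewrite Eu => /(walk_of_inj vd ve)/(congr1 size); rewrite size_drop; lia.
Qed.

Lemma flatten_walk_of cs : all prime_code cs ->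
  flatten (map walk_of cs) = walk_of (flatten (rev cs)).
Proof.
elim: cs => //= e cs IH /andP[pr_e pr_cs].
rewrite rev_cons flatten_rcons walk_of_cat ?IH //.
by apply: valid_flatten; rewrite all_rev.
Qed.

Lemma walk_prime_factorsP c ws : valid c -> walk_prime_factors (walk_of c) ws ->
  exists cs, [/\ all prime_code cs, ws = map walk_of cs & c = flatten (rev cs)].
Proof.
move=> vc [Ec prime_ws].
have code_ws u : u \in ws -> prime_code (code_of u) /\ walk_of (code_of u) = u.
  move=> u_in; pose i := index u ws.
  have split_ws : ws = take i ws ++ u :: drop i.+1 ws.
    by rewrite -{1}(nth_index u u_in) -drop_nth ?index_mem // cat_take_drop.
  have [|e pr_e ->] := prime_walk_factorP vc _ (prime_ws _ _ _ split_ws).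
    by rewrite -Ec [in RHS]split_ws flatten_cat.
  by rewrite code_of_walk_of // prime_code_valid.
have pr : all prime_code (map code_of ws).
  by rewrite all_map; apply/allP => u /code_ws[].
have Ews : ws = map walk_of (map code_of ws).
  by rewrite -map_comp map_id_in // => u /code_ws[].
exists (map code_of ws); split=> //; apply: walk_of_inj => //.
  by apply: valid_flatten; rewrite all_rev.
by rewrite -flatten_walk_of // -Ews Ec.
Qed.

(** * Area *)

Lemma size_walk_of_ge c : size c <= size (walk_of c).
Proof. by rewrite -(count_East_walk_to 0 c) count_size. Qed.

Lemma east_points_lt k c e : e \in east_points k c -> (e.1 < Posz (size c + k))%R.
Proof.
elim: c => //= a c IH; rewrite mem_rcons inE => /predU1P[->|/IH] /=; lia.
Qed.

Lemma card_squares L c : valid c -> size c <= L ->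
  #|[set q : 'I_L * 'I_(2 * L) |
      (- Posz q.1 <= Posz q.2 - Posz L)%R &&
      has (fun e : point => (e.1 == Posz q.1) && (Posz q.2 - Posz L + 1 <= e.2)%R)
        (east_points 0 c)]| = sumn c.
Proof.
elim: c => [|a c IH] vac le_L.
  by apply: eq_card0 => q; rewrite !inE andbF.
rewrite /= in le_L; case/andP: (vac) => le_a vc; rewrite /= -(IH vc (ltnW le_L)).
(* The last column, of abscissa [size c], contributes the [a] squares with lower ordinates
   [x - size c]; adding [L] gives their index. *)
have square_lt (x : 'I_a) : L - size c + x < 2 * L by have := ltn_ord x; move: le_L => /=; lia.
pose f (x : 'I_a) : 'I_L * 'I_(2 * L) := (Ordinal le_L, Ordinal (square_lt x)).
have f_inj : injective f by move=> x y [] /addnI /val_inj.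
rewrite -[X in _ = (X + _)%N](card_ord a) -(card_imset _ f_inj) -cardsUI.
rewrite [X in _ = (_ + X)%N](_ : _ = 0) ?addn0.
  apply: eq_card => -[x y]; rewrite !inE has_rcons andb_orr; congr (_ || _).
  apply/idP/imsetP => [|[z _ [-> ->]]] /=; last by have := ltn_ord z; lia.
  move=> /andP[ge_y /andP[/eqP Ex lt_y]].
  have lt_z : y - (L - size c) < a by move: ge_y Ex lt_y => /=; lia.
  exists (Ordinal lt_z) => //; congr (_, _); apply: val_inj => /=; move: ge_y Ex lt_y => /=; lia.
(* These squares are new, since the earlier east steps lie in columns before [size c]. *)
apply: eq_card0 => q; rewrite !inE; apply/negP => /andP[/imsetP[z _ ->] /andP[_ /hasP[e]]].
by move=> /east_points_lt lt_e /andP[/eqP Ee _]; move: lt_e; rewrite Ee /=; lia.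
Qed.

Lemma area_walk_of c : valid c -> area (walk_of c) = sumn c.
Proof.
move=> vc; rewrite -(card_squares vc (size_walk_of_ge c)).
by apply: eq_card => q; rewrite !inE /square_between /= diag_point_origin east_steps_walk_of.
Qed.

(** * Matchings *)

(* Relabelling of the points when a pair {0, a + 1} is inserted. *)
Definition shift2 (a x : nat) : nat := (a <= x) + x.+1.

Definition unshift2 (a y : nat) : nat := y.-1 - (a < y).

Fixpoint arcs (c : seq nat) : seq (nat * nat) :=
  if c is a :: c' then (0, a.+1) :: [seq (shift2 a y.1, shift2 a y.2) | y <- arcs c']
  else [::].

Definition link (c : seq nat) (i j : nat) : bool :=
  ((i, j) \in arcs c) || ((j, i) \in arcs c).

Lemma shift2K a : cancel (shift2 a) (unshift2 a).
Proof. by move=> x; rewrite /unshift2 /shift2; case: leqP; lia. Qed.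

Lemma unshift2K a y : y != 0 -> y != a.+1 -> shift2 a (unshift2 a y) = y.
Proof. by rewrite /unshift2 /shift2 => y0 ya; case: (ltnP a y); case: leqP; lia. Qed.

Lemma ltn_shift2 a x y : (shift2 a x < shift2 a y) = (x < y).
Proof. by rewrite /shift2; case: (leqP a x); case: (leqP a y); lia. Qed.

Lemma shift2_neq a x : (shift2 a x != 0) && (shift2 a x != a.+1).
Proof. by rewrite /shift2; case: leqP; lia. Qed.

Lemma link_sym c i j : link c i j = link c j i.
Proof. by rewrite /link orbC. Qed.

Lemma link_cons a c i j : link (a :: c) i j =
  [|| (i == 0) && (j == a.+1), (j == 0) && (i == a.+1) |
      [&& i != 0, i != a.+1, j != 0, j != a.+1 & link c (unshift2 a i) (unshift2 a j)]].
Proof.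
have inE2 x y : ((x, y) \in [seq (shift2 a y.1, shift2 a y.2) | y <- arcs c]) =
   [&& x != 0, x != a.+1, y != 0, y != a.+1 & (unshift2 a x, unshift2 a y) \in arcs c].
  apply/mapP/idP => [[[u v] uv [-> ->]]|/and5P[x0 xa y0 ya xy]].
    by have /andP[-> ->] := shift2_neq a u; have /andP[-> ->] := shift2_neq a v; rewrite !shift2K.
  by exists (unshift2 a x, unshift2 a y); rewrite //= !unshift2K.
rewrite /link /= !inE !inE2 !xpair_eqE.
by case: (i == 0) (i == a.+1) (j == 0) (j == a.+1) => [] [] [] [];
   rewrite /= ?orbF ?orbT.
Qed.

Lemma link0 a c j : link (a :: c) 0 j = (j == a.+1).
Proof. by rewrite link_cons /= ?andbF ?orbF. Qed.

Lemma link_head a c j : link (a :: c) a.+1 j = (j == 0).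
Proof. by rewrite link_cons eqxx /= andbT orbF. Qed.

Lemma link_shift2 a c i j : link (a :: c) (shift2 a i) (shift2 a j) = link c i j.
Proof.
have /andP[/negbTE i0 /negbTE ia] := shift2_neq a i.
have /andP[/negbTE j0 /negbTE ja] := shift2_neq a j.
by rewrite link_cons i0 ia j0 ja !shift2K.
Qed.

Lemma link_functional c i j k : link c i j -> link c i k -> j = k.
Proof.
elim: c i j k => // a c IH i j k.
have [->|i0] := eqVneq i 0; first by rewrite !link0 => /eqP -> /eqP ->.
have [->|ia] := eqVneq i a.+1; first by rewrite !link_head => /eqP -> /eqP ->.
rewrite !link_cons (negbTE i0) (negbTE ia) !andbF /=.
move=> /and3P[j0 ja lj] /and3P[k0 ka lk].
by rewrite -(unshift2K j0 ja) -(unshift2K k0 ka) (IH _ _ _ lj lk).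
Qed.

Lemma arcs_ltn c y : y \in arcs c -> y.1 < y.2.
Proof.
elim: c y => //= a c IH y; rewrite inE => /predU1P[->|/mapP[z /IH lt_z ->]] //=.
by rewrite ltn_shift2.
Qed.

Lemma link_ltn c i j : i < j -> link c i j = ((i, j) \in arcs c).
Proof.
move=> lt_ij; rewrite /link orbC; case: (boolP ((j, i) \in _)) => // /arcs_ltn /=.
by rewrite ltnNge ltnW.
Qed.

Lemma link_neq c i j : link c i j -> i != j.
Proof. by case/orP=> /arcs_ltn /= lt_ij; rewrite neq_ltn lt_ij ?orbT. Qed.

Lemma link_bound c i j : valid c -> link c i j -> i < 2 * size c.
Proof.
elim: c i j => // a c IH i j /andP[le_a vc].
rewrite link_cons => /or3P[/andP[/eqP-> _]|/andP[_ /eqP->]|/and5P[i0 ia _ _ /IH]] /=; [lia|lia|].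
by move=> /(_ vc); rewrite -[i in X in _ -> X](unshift2K i0 ia) /shift2; case: leqP; lia.
Qed.

Lemma link_total c i : valid c -> i < 2 * size c -> exists j, link c i j.
Proof.
elim: c i => [|a c IH] i; first by rewrite muln0.
move=> /andP[le_a vc] lt_i.
have [->|i0] := eqVneq i 0; first by exists a.+1; rewrite link0.
have [->|ia] := eqVneq i a.+1; first by exists 0; rewrite link_head.
have [|j lj] := IH (unshift2 a i) vc.
  by move: lt_i i0 ia; rewrite /unshift2 /=; case: ltnP; lia.
by exists (shift2 a j); rewrite -(unshift2K i0 ia) link_shift2.
Qed.

(** The partner of 0 gives the head, and undoing the relabelling gives the links of the tail. *)
Lemma link_inj c c' : valid c -> valid c' -> size c = size c' ->
  (forall i j, link c i j = link c' i j) -> c = c'.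
Proof.
elim: c c' => [|a c IH] [|b c'] // /andP[_ vc] /andP[_ vc'] [sz] E.
have /eqP[Eab] : a.+1 == b.+1 by rewrite -(link0 b c') -E link0.
rewrite -{}Eab in E *; congr cons; apply: IH => // i j.
by rewrite -(link_shift2 a) E link_shift2.
Qed.

(** Remove the pair formed by 0 and its image [a.+1]: conjugating by [shift2 a] gives a
    fixed-point-free involution on two points fewer, and [a] is the head of the code. *)
Lemma ex_code_of_involution n (F : nat -> nat) :
  (forall i, i < 2 * n -> [/\ F i < 2 * n, F i != i & F (F i) = i]) ->
  exists c, [/\ valid c, size c = n & forall i, i < 2 * n -> link c i (F i)].
Proof.
elim: n F => [|n IH] F FP; first by exists [::]; split=> // i; rewrite muln0.
have [|F0_lt F0_neq FF0] := FP 0; first by lia.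
case EF0: (F 0) F0_neq => [//|a] _.
have le_a : a <= 2 * n by lia.
have F_shift x : x < 2 * n -> [/\ F (shift2 a x) != 0, F (shift2 a x) != a.+1 &
    [/\ F (shift2 a x) < 2 * n.+1, F (shift2 a x) != shift2 a x & F (F (shift2 a x)) = shift2 a x]].
  move=> lt_x; have [|lt_F neq_F FF] := FP (shift2 a x).
    by rewrite /shift2; case: leqP; lia.
  have /andP[s0 sa] := shift2_neq a x; split=> //.
    by apply: contraNneq sa => E; rewrite -FF E EF0.
  by apply: contraNneq s0 => E; rewrite -FF E -EF0 FF0.
have [|c [vc sz lc]] := IH (fun x => unshift2 a (F (shift2 a x))).
  move=> x lt_x; have [F0 Fa [lt_F neq_F FF]] := F_shift x lt_x.
  rewrite (unshift2K F0 Fa) FF shift2K; split=> //.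
    by move: F0 Fa lt_F; rewrite /unshift2; case: ltnP; lia.
  by apply: contraNneq neq_F => /(congr1 (shift2 a)); rewrite unshift2K // => ->.
exists (a :: c); split=> /=; [by rewrite sz le_a|by rewrite sz|].
move=> i lt_i; have [->|i0] := eqVneq i 0; first by rewrite EF0 link0.
have [->|ia] := eqVneq i a.+1; first by rewrite -{2}EF0 FF0 link_head.
have lt_x : unshift2 a i < 2 * n.
  by move: lt_i i0 ia; rewrite /unshift2; case: ltnP; lia.
have [F0 Fa _] := F_shift _ lt_x; rewrite unshift2K // in F0 Fa.
have := lc _ lt_x; rewrite unshift2K // -(link_shift2 a) !unshift2K //.
Qed.

(** Ties the two descriptions of a matching together: the closers in [word] sit at the right ends of
    [arcs]. *)
Lemma count_closers c b : valid c ->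
  count (fun y => y.2 < b) (arcs c) = count id (take b (word c)).
Proof.
elim: c b => [|a c IH] [|b] // /andP[le_a vc].
  by rewrite take0; elim: (arcs _).
have sz_a : size (take a (word c)) = a by rewrite size_takel ?size_word.
have count_b k : (forall x, (shift2 a x < b.+1) = (x < k)) ->
  count (fun y => y.2 < b.+1) (arcs (a :: c)) = (a < b) + count id (take k (word c)).
  by move=> E; rewrite -IH //= count_map; congr (_ + _); apply: eq_count => y; apply: E.
rewrite -[RHS]/(count id (take b (take a (word c) ++ true :: drop a (word c)))).
case: (leqP b a) => [le_ba|lt_ab].
  rewrite (count_b b) => [|x]; last by rewrite /shift2; case: leqP; lia.
  by rewrite takel_cat ?sz_a // take_takel // ltnNge le_ba.
rewrite (count_b b.-1) => [|x]; last by rewrite /shift2; case: leqP; lia.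
rewrite lt_ab take_cat sz_a ltnNge ltnW //= count_cat.
have -> : b - a = (b.-1 - a).+1 by lia.
rewrite /= addnCA -count_cat -takeD; congr (_ + count id (take _ _)); lia.
Qed.

(** Each of the positions below [b] is an endpoint of exactly one arc. *)
Lemma count_endpoints c b : valid c -> b <= 2 * size c ->
  count (fun y => y.1 < b) (arcs c) + count (fun y => y.2 < b) (arcs c) = b.
Proof.
elim: c b => [|a c IH] [|b] // /andP[le_a vc] le_b.
  by elim: (arcs _).
have count_b k : (forall x, (shift2 a x < b.+1) = (x < k)) -> k <= 2 * size c ->
  count (fun y => y.1 < b.+1) (arcs (a :: c)) + count (fun y => y.2 < b.+1) (arcs (a :: c)) =
  1 + (a < b) + k.
  move=> E le_k; rewrite -[in RHS](IH k vc le_k) /= !count_map ltnS.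
  rewrite (eq_count (a2 := fun y => y.1 < k)) => [|y]; last exact: E.
  rewrite (eq_count (a1 := preim _ _) (a2 := fun y => y.2 < k)) => [|y]; last exact: E.
  lia.
case: (leqP b a) => [le_ba|lt_ab].
  rewrite (count_b b) ?ltnNge ?le_ba //; last by lia.
  by move=> x; rewrite /shift2; case: leqP; lia.
rewrite (count_b b.-1) ?lt_ab //.
- lia.
- by move=> x; rewrite /shift2; case: leqP; lia.
- by move: le_b => /=; lia.
Qed.

(** * Nestings and crossings of arcs *)

Definition pair_count (T : Type) (P : rel T) (s : seq T) : nat :=
  \sum_(x <- s) count (P x) s.

Definition nested : rel (nat * nat) := fun x y => (x.1 < y.1) && (y.2 < x.2).

Definition crossed : rel (nat * nat) :=
  fun x y => [&& x.1 < y.1, y.1 < x.2 & x.2 < y.2].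

(** The inserted arc has the smallest opener, so it occurs only as the first member of a pair. *)
Lemma pair_count_arcs_cons (P : rel (nat * nat)) a c :
  (forall x y, P x y -> x.1 < y.1) ->
  (forall x y, P (shift2 a x.1, shift2 a x.2) (shift2 a y.1, shift2 a y.2) = P x y) ->
  pair_count P (arcs (a :: c)) =
  count (fun y => P (0, a.+1) (shift2 a y.1, shift2 a y.2)) (arcs c) + pair_count P (arcs c).
Proof.
move=> P_lt P_shift; rewrite /pair_count big_cons big_map /= count_map.
have P_head x : P x (0, a.+1) = false by apply/negP => /P_lt.
rewrite P_head add0n; congr (_ + _); apply: eq_bigr => x _.
by rewrite P_head count_map add0n; apply: eq_count => y /=; rewrite P_shift.
Qed.

Lemma pair_count_nested c : valid c -> pair_count nested (arcs c) = nests c.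
Proof.
elim: c => [|a c IH] /=; first by rewrite /pair_count big_nil.
case/andP=> _ vc; rewrite pair_count_arcs_cons.
- rewrite IH // -count_closers //; congr (_ + _); apply: eq_count => y /=.
  by rewrite /nested /shift2 /=; case: (leqP a y.2); lia.
- by move=> x y /andP[].
by move=> x y; rewrite /nested /= !ltn_shift2.
Qed.

(** Among the [a] points below the inserted arc, each arc crossing it has one endpoint and each arc
    nested in it has two; hence [a] and the number of new crossings have the same parity. *)
Lemma odd_pair_count_crossed c : valid c ->
  odd (pair_count crossed (arcs c)) = odd (sumn c).
Proof.
elim: c => [|a c IH] /=; first by rewrite /pair_count big_nil.
case/andP=> le_a vc; rewrite pair_count_arcs_cons; first last.
- by move=> x y; rewrite /crossed /= !ltn_shift2.
- by move=> x y /andP[].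
rewrite !oddD IH //; congr (_ (+) _).
rewrite (eq_in_count (a2 := fun y => (y.1 < a) && ~~ (y.2 < a))); last first.
  move=> [u v] /arcs_ltn /= lt_uv; rewrite /crossed /shift2 /=.
  by case: (leqP a u); case: (leqP a v); lia.
have : count (fun y => y.1 < a) (arcs c) =
    count (fun y => (y.1 < a) && ~~ (y.2 < a)) (arcs c) + count (fun y => y.2 < a) (arcs c).
  rewrite -count_predUI [X in _ = _ + X](@eq_count _ _ pred0); last first.
    by move=> y /=; case: (y.2 < a); rewrite ?andbF ?andbT.
  rewrite count_pred0 addn0; apply: eq_in_count => -[u v] /arcs_ltn /= lt_uv.
  by apply/idP/idP; lia.
move=> E; rewrite -[in RHS](count_endpoints vc le_a) E -addnA addnn.
by rewrite oddD odd_double addbF.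
Qed.

Lemma card_arc_pairs (P : rel (nat * nat)) d c : (forall i j, link c i j -> i < d) ->
  uniq (arcs c) ->
  #|[set q : 'I_d * 'I_d * 'I_d * 'I_d | let: (i, j, k, l) := q in
     [&& ((i : nat, j : nat) \in arcs c), ((k : nat, l : nat) \in arcs c) &
         P (i : nat, j : nat) (k : nat, l : nat)]]| =
  pair_count P (arcs c).
Proof.
move=> bound uniq_c.
pose f (q : 'I_d * 'I_d * 'I_d * 'I_d) : (nat * nat) * (nat * nat) :=
  let: (i, j, k, l) := q in ((i : nat, j : nat), (k : nat, l : nat)).
have f_inj : injective f.
  by move=> [[[i j] k] l] [[[i' j'] k'] l'] [/val_inj -> /val_inj -> /val_inj -> /val_inj ->].
have -> : pair_count P (arcs c) =
    size [seq z <- [seq (x, y) | x <- arcs c, y <- arcs c] | P z.1 z.2].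
  rewrite size_filter -sum1_count big_mkcond big_allpairs_dep.
  by apply: eq_bigr => x _; rewrite -sum1_count [LHS]big_mkcond.
rewrite cardE -(size_map f); apply/perm_size/uniq_perm.
- by rewrite map_inj_uniq ?enum_uniq.
- by apply/filter_uniq/allpairs_uniq => // -[? ?] [? ?] _ _ [-> ->].
move=> [[i j] [k l]]; rewrite mem_filter /=; apply/mapP/andP.
  case=> [[[[i' j'] k'] l']]; rewrite mem_enum inE => /and3P[ij kl Pijkl] [-> -> -> ->].
  by split=> //; apply: allpairs_f.
case=> Pijkl /allpairsP[[x y] [/= xin yin [Ex Ey]]]; rewrite -{}Ex -{}Ey in xin yin.
have lij : link c i j by rewrite /link xin.
have lkl : link c k l by rewrite /link yin.
have lt_i := bound _ _ lij; rewrite link_sym in lij; have lt_j := bound _ _ lij.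
have lt_k := bound _ _ lkl; rewrite link_sym in lkl; have lt_l := bound _ _ lkl.
exists (Ordinal lt_i, Ordinal lt_j, Ordinal lt_k, Ordinal lt_l) => //.
by rewrite mem_enum inE /= xin yin.
Qed.

Lemma arcs_uniq c : uniq (arcs c).
Proof.
elim: c => //= a c IH; rewrite map_inj_uniq ?IH => [|[i j] [k l] [E1 E2]].
  by rewrite andbT; apply/mapP => -[y _ [E _]]; have := shift2_neq a y.1; rewrite -E.
by rewrite -(shift2K a i) -(shift2K a j) E1 E2 !shift2K.
Qed.

(** * Matchings as sets of blocks *)

Definition matching_of (d : nat) (c : seq nat) : {set {set 'I_d}} :=
  [set [set q.1; q.2] | q : 'I_d * 'I_d & link c q.1 q.2].

Lemma mem_matching_of d c (i j : 'I_d) : ([set i; j] \in matching_of d c) = link c i j.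
Proof.
apply/imsetP/idP => [[[x y]]|lij]; last by exists (i, j); rewrite ?inE.
rewrite inE /= => lxy E.
have /set2P[Ei|Ei] : i \in [set x; y] by rewrite -E set21.
  have /set2P[Ej|Ej] : j \in [set x; y] by rewrite -E set22.
    have : y \in [set i; j] by rewrite E set22.
    by rewrite Ei Ej !inE orbb => /eqP Eyx; rewrite -{2}Eyx.
  by rewrite Ei Ej.
have /set2P[Ej|Ej] : j \in [set x; y] by rewrite -E set22.
  by rewrite Ei Ej link_sym.
have : x \in [set i; j] by rewrite E set21.
by rewrite Ei Ej !inE orbb => /eqP Exy; rewrite -{1}Exy.
Qed.

Lemma in_matching_of d c (B : {set 'I_d}) : B \in matching_of d c ->
  exists i j, B = [set i; j] /\ link c i j.
Proof. by case/imsetP=> -[i j]; rewrite inE => lij ->; exists i, j. Qed.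

Lemma is_matching_of c : valid c -> is_matching (matching_of (2 * size c) c).
Proof.
move=> vc; apply/andP; split; last first.
  apply/forall_inP => B /in_matching_of[i [j [-> /link_neq]]].
  by rewrite cards2 => ->.
apply/and3P; split.
- rewrite eqEsubset subsetT; apply/subsetP => i _.
  have [j lij] := link_total vc (ltn_ord i).
  have lt_j : j < 2 * size c by apply: (@link_bound c j i); rewrite 1?link_sym.
  by apply/bigcupP; exists [set i; Ordinal lt_j]; rewrite ?mem_matching_of ?set21.
- apply/trivIsetP => A B /in_matching_of[i [j [-> lij]]] /in_matching_of[k [l [-> lkl]]].
  apply: contraNT => /pred0Pn[x /andP[/= xij xkl]]; apply/eqP.
  have mate (u v : 'I_(2 * size c)) : link c u v -> x \in [set u; v] ->
      exists2 y, [set u; v] = [set x; y] & link c x y.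
    move=> luv /set2P[->|->]; [by exists v|exists u; [exact: setUC|by rewrite link_sym]].
  have [y -> lxy] := mate _ _ lij xij; have [z -> lxz] := mate _ _ lkl xkl.
  by rewrite (val_inj (link_functional lxy lxz)).
apply/negP => /in_matching_of[i [j [/esym/eqP E _]]].
by move: E; apply/negP/set0Pn; exists i; rewrite set21.
Qed.

Lemma matching_of_inj n c c' : valid c -> valid c' -> size c = n -> size c' = n ->
  matching_of (2 * n) c = matching_of (2 * n) c' -> c = c'.
Proof.
move=> vc vc' sz sz' E; apply: link_inj => //; first by rewrite sz.
have sub e e' i j : size e = n -> valid e -> matching_of (2 * n) e = matching_of (2 * n) e' ->
    link e i j -> link e' i j.
  move=> sz_e ve Ee lij; have lt_i : i < 2 * n by rewrite -sz_e; apply: link_bound lij.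
  have lt_j : j < 2 * n by rewrite -sz_e; apply: (@link_bound e j i) => //; rewrite link_sym.
  by have := mem_matching_of e (Ordinal lt_i) (Ordinal lt_j); rewrite Ee mem_matching_of /= lij.
by move=> i j; apply/idP/idP; apply: sub.
Qed.

Lemma matching_mate d (m : {set {set 'I_d}}) : is_matching m ->
  set0 \notin m /\ exists f : 'I_d -> 'I_d, forall i,
    [/\ f i != i, f (f i) = i & forall B, (B \in m) && (i \in B) = (B == [set i; f i])].
Proof.
case/andP=> /and3P[/eqP cover_m triv_m m0] /forall_inP card2.
have block i : exists j : 'I_d, (j != i) && ([set i; j] \in m).
  have : i \in cover m by rewrite cover_m in_setT.
  case/bigcupP=> B Bm iB; have /card2/cards2P[x [y [xy EB]]] := Bm.
  move: iB; rewrite EB => /set2P[->|->]; [exists y|exists x].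
    by rewrite eq_sym xy -EB Bm.
  by rewrite xy setUC -EB Bm.
pose f i := xchoose (block i).
have fP i : (f i != i) && ([set i; f i] \in m) := xchooseP (block i).
have f_block i B : B \in m -> i \in B -> B = [set i; f i].
  have /andP[_ fm] := fP i => Bm iB.
  by rewrite -(def_pblock triv_m Bm iB) (def_pblock triv_m fm) ?set21.
split=> //; exists f => i; have /andP[fi fm] := fP i; split=> //.
  have E := f_block (f i) _ fm (set22 _ _).
  have : i \in [set f i; f (f i)] by rewrite -E set21.
  by rewrite !inE eq_sym (negbTE fi) /= => /eqP.
move=> B; apply/andP/eqP => [[Bm iB]|->]; first exact: f_block.
by rewrite set21.
Qed.

Lemma matching_of_surj n (m : {set {set 'I_(2 * n)}}) : is_matching m ->
  exists c, [/\ valid c, size c = n & matching_of (2 * n) c = m].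
Proof.
(* [F] is the mate function on natural numbers, with default value 0 outside the range. *)
case/matching_mate=> m0 [f fP]; pose F k := if insub k is Some i then val (f i) else 0.
have FE (i : 'I_(2 * n)) : F i = f i by rewrite /F valK.
have [k lt_k|c [vc sz lc]] := @ex_code_of_involution n F.
  have [fi ff _] := fP (Ordinal lt_k).
  by rewrite -[k]/(val (Ordinal lt_k)) FE; split; rewrite ?ltn_ord // FE ff.
have block (i : 'I_(2 * n)) : [set i; f i] \in m.
  by have [_ _ /(_ [set i; f i])] := fP i; rewrite eqxx => /andP[].
exists c; split=> //; apply/setP => B; apply/idP/idP => [/in_matching_of[i [j [-> lij]]]|Bm].
  have := lc i (ltn_ord i); rewrite FE => /(link_functional lij)/val_inj ->.
  exact: block.
have [i iB] : exists i, i \in B by apply/set0Pn; apply: contraTneq Bm => ->.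
have [_ _ /(_ B)] := fP i; rewrite Bm iB => /esym/eqP ->.
by rewrite mem_matching_of -FE lc.
Qed.

Lemma nestings_matching_of c : valid c ->
  nestings (matching_of (2 * size c) c) = nests c.
Proof.
move=> vc; rewrite -pair_count_nested // -(@card_arc_pairs _ (2 * size c)) ?arcs_uniq //.
  apply: eq_card => -[[[i j] k] l]; rewrite !inE !mem_matching_of /nested /=.
  apply/and5P/and4P => [[lij lkl ik kl lj]|[ij kl ik lj]].
    have ij : i < j by apply: ltn_trans lj; apply: ltn_trans kl.
    by rewrite -!link_ltn // ik lj.
  have /= lt_kl := arcs_ltn kl; have /= lt_ij := arcs_ltn ij.
  by rewrite !link_ltn.
by move=> i j; apply: link_bound.
Qed.

Lemma crossings_matching_of c : valid c ->
  odd (crossings (matching_of (2 * size c) c)) = odd (sumn c).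
Proof.
move=> vc; rewrite -odd_pair_count_crossed // -(@card_arc_pairs _ (2 * size c)) ?arcs_uniq //.
  congr (odd _); apply: eq_card => -[[[i j] k] l]; rewrite !inE !mem_matching_of /crossed /=.
  apply/and5P/and5P => [[lij lkl ik kj jl]|[ij kl ik kj jl]].
    by rewrite -!link_ltn //; [apply: ltn_trans jl|apply: ltn_trans kj].
  have /= lt_kl := arcs_ltn kl; have /= lt_ij := arcs_ltn ij.
  by rewrite !link_ltn.
by move=> i j; apply: link_bound.
Qed.

Lemma matched_matching_of a c (M : int) : valid (a :: c) ->
  matched (matching_of (2 * (size c).+1) (a :: c)) 1 M <-> M = (a.+2)%:Z%R.
Proof.
move=> vac; split=> [[i [j [[i0] -> ]]]|->].
  by rewrite mem_matching_of -i0 link0 => /eqP ->.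
have lt_a : a.+1 < 2 * (size c).+1 by case/andP: vac; lia.
by exists (Ordinal (ltn_trans (ltn0Sn a) lt_a)), (Ordinal lt_a); rewrite mem_matching_of link0.
Qed.

(** * Factors of matchings *)

Lemma link_catr c1 c2 x y : valid c1 ->
  link (c1 ++ c2) (2 * size c1 + x) (2 * size c1 + y) = link c2 x y.
Proof.
elim: c1 => [|a c1 IH]; first by rewrite muln0.
case/andP=> le_a v1; rewrite -IH // -[RHS](link_shift2 a) /=.
by congr (link _ _ _); rewrite /shift2; case: leqP; lia.
Qed.

Lemma link_catl c1 c2 x y : valid c1 -> x < 2 * size c1 -> link (c1 ++ c2) x y = link c1 x y.
Proof.
elim: c1 x y => [|a c1 IH] x y; first by rewrite muln0.
case/andP=> le_a v1 lt_x; rewrite cat_cons.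
have [->|x0] := eqVneq x 0; first by rewrite !link0.
have [->|xa] := eqVneq x a.+1; first by rewrite !link_head.
rewrite !link_cons IH //; move: lt_x x0 xa; rewrite /unshift2 /=.
by case: (ltnP a x); lia.
Qed.

Lemma link_factor c1 e c2 x j : valid c1 -> valid e -> x < 2 * size e ->
  link (c1 ++ e ++ c2) (2 * size c1 + x) j ->
  exists y, [/\ j = 2 * size c1 + y, y < 2 * size e & link e x y].
Proof.
move=> v1 ve lt_x lxj; have [y lxy] := link_total ve lt_x.
exists y; split=> //; last by apply: (@link_bound e y x); rewrite 1?link_sym.
by apply: link_functional lxj _; rewrite link_catr // link_catl.
Qed.

(** A nonempty initial interval closed under matching contains the pair {0, a + 1}; removing that
    pair leaves a closed interval of length t - 2 for the tail. The inequality a + 1 < t gives the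
    bound on the head of the prefix. *)
Lemma closed_prefix e t : valid e -> t <= 2 * size e ->
  (forall x y, x < t -> link e x y -> y < t) ->
  exists k, [/\ t = 2 * k, k <= size e & valid (take k e)].
Proof.
elim: e t => [|a e IH] t.
  by move=> _; rewrite muln0 leqn0 => /eqP-> _; exists 0.
case/andP=> le_a ve le_t closed_t.
case: (posnP t) => [->|t0]; first by exists 0.
have lt_a : a.+1 < t by apply: (closed_t 0); rewrite ?link0.
have [|x y lt_x lxy|k [Et le_k vk]] := IH (t - 2) ve.
- by move: le_t => /=; lia.
- have : shift2 a y < t.
    by apply: (closed_t (shift2 a x)); rewrite ?link_shift2 // /shift2; case: leqP; lia.
  by rewrite /shift2; case: leqP; lia.
exists k.+1; split=> //; first by lia.
by rewrite /= vk andbT size_takel //; lia.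
Qed.

Lemma prime_matching_factor_of c1 e c2 d : valid c1 -> prime_code e ->
  d = 2 * size (c1 ++ e ++ c2) ->
  prime_matching_factor (matching_of d (c1 ++ e ++ c2)) (2 * size c1) (2 * size c1 + 2 * size e).
Proof.
move=> v1 pr_e Ed; have ve := prime_code_valid pr_e.
have e0 : 0 < size e by case/and3P: pr_e => /size_code_gt0.
have le_d : 2 * size c1 + 2 * size e <= d by rewrite Ed !size_cat; lia.
have in_interval (i : 'I_d) : i \in Defs.interval d (2 * size c1) (2 * size c1 + 2 * size e) ->
    exists2 x, i = 2 * size c1 + x :> nat & x < 2 * size e.
  by rewrite inE => /andP[le_i lt_i]; exists (i - 2 * size c1); lia.
split.
  apply/andP; split; first by rewrite le_d; lia.
  apply/forall_inP => i /in_interval[x Ei lt_x]; apply/exists_inP.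
  have [y lxy] := link_total ve lt_x.
  have lt_y : y < 2 * size e by apply: (@link_bound e y x); rewrite 1?link_sym.
  have lt_j : 2 * size c1 + y < d by lia.
  exists (Ordinal lt_j); first by rewrite inE /=; lia.
  by rewrite mem_matching_of Ei link_catr // link_catl.
move=> b /andP[lt_b lt_be] [/andP[_ /forall_inP closed_b] _].
have [|x y lt_x lxy|k [Eb le_k vk]] := @closed_prefix e (b - 2 * size c1) ve; first by lia.
- have lt_i : 2 * size c1 + x < d by lia.
  have lt_xe : x < 2 * size e by lia.
  have /exists_inP[j] := closed_b (Ordinal lt_i) ltac:(rewrite inE /=; lia).
  rewrite inE mem_matching_of /= => /andP[le_j lt_j] lxj.
  have [z [Ej _ lxz]] := link_factor v1 ve lt_xe lxj.
  by rewrite (link_functional lxy lxz); lia.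
have k0 : take k e != [::] by rewrite -size_eq0 size_takel //; lia.
(* A cut at [b] would make [take k e] a nonempty valid prefix, so primality makes it all of [e],
   against [b] lying before the end. *)
have /(congr1 size) : drop k e = [::].
  by apply: (@prime_code_prefix (take k e)); rewrite ?cat_take_drop.
by rewrite size_drop /=; lia.
Qed.

Lemma submatching_matching_of c1 e c2 d : valid c1 -> valid e ->
  d = 2 * size (c1 ++ e ++ c2) ->
  submatching (matching_of d (c1 ++ e ++ c2)) (2 * size c1) (2 * size e) =
  matching_of (2 * size e) e.
Proof.
move=> v1 ve Ed; set k := 2 * size e; set a := 2 * size c1.
have le_d : a + k <= d by rewrite Ed !size_cat /a /k; lia.
have shiftP (x : 'I_k) : a + x < d by have := ltn_ord x; lia.
have relabel (i j : 'I_d) (x y : 'I_k) : i = a + x :> nat -> j = a + y :> nat ->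
    [set z : 'I_k | [exists t in [set i; j], t == a + z :> nat]] = [set x; y].
  move=> Ei Ej; apply/setP => z; rewrite inE; apply/exists_inP/set2P.
    by case=> t /set2P[->|->] /eqP; rewrite ?Ei ?Ej => /addnI/val_inj ->; [left|right].
  by case=> ->; [exists i|exists j]; rewrite ?set21 ?set22 // ?Ei ?Ej.
apply/setP => X; apply/imsetP/idP.
  case=> B; rewrite inE => /andP[/in_matching_of[i [j [-> lij]]] /subsetP sub] ->.
  have := sub i (set21 _ _); rewrite inE => /andP[le_i lt_i].
  have lt_x : i - a < k by lia.
  have Ei : i = a + Ordinal lt_x :> nat by rewrite /=; lia.
  have := lij; rewrite {1}Ei => /(link_factor v1 ve lt_x)[y [Ej lt_y lxy]].
  by rewrite (relabel i j (Ordinal lt_x) (Ordinal lt_y)) // mem_matching_of.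
case/in_matching_of=> x [y [-> lxy]].
exists [set Ordinal (shiftP x); Ordinal (shiftP y)]; last first.
  by rewrite (relabel _ _ x y).
rewrite inE mem_matching_of /= link_catr // link_catl // lxy.
apply/subsetP => t /set2P[] ->; rewrite inE /= leq_addr ltn_add2l; exact: ltn_ord.
Qed.

Lemma total_size_matching_of cs :
  total_size [seq Sized (matching_of (2 * size e) e) | e <- cs] = 2 * size (flatten cs).
Proof.
elim: cs => [|e cs IH]; first by rewrite /total_size big_nil.
by rewrite /total_size /= big_cons -/(total_size _) IH size_cat mulnDr.
Qed.

Lemma matching_prime_factors_of cs : all prime_code cs ->
  matching_prime_factors (matching_of (2 * size (flatten cs)) (flatten cs))
    [seq Sized (matching_of (2 * size e) e) | e <- cs].
Proof.
move=> pr; split; first exact: total_size_matching_of.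
move=> us f vs E; pose i := size us.
have [Eus Ef Evs] : [/\ us = [seq Sized (matching_of (2 * size e) e) | e <- take i cs],
    f = Sized (matching_of (2 * size (nth [::] cs i)) (nth [::] cs i)) &
    cs = take i cs ++ nth [::] cs i :: drop i.+1 cs].
  have lt_i : i < size cs.
    by rewrite -(size_map (fun e => Sized (matching_of (2 * size e) e))) E size_cat /=; lia.
  split; last by rewrite -drop_nth // cat_take_drop.
    by rewrite map_take E take_size_cat.
  by rewrite -(nth_map _ f (fun e => Sized (matching_of (2 * size e) e))) // E nth_cat ltnn subnn.
rewrite Ef Eus total_size_matching_of; move: (nth _ _ _) (take _ _) (drop _ _) Evs.
move=> e cs1 cs2 Ecs; rewrite {}Ecs {E Eus Ef} in pr *.
move: pr; rewrite all_cat /= => /and3P[/valid_flatten v1 pr_e _].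
rewrite flatten_cat /=; split; first exact: prime_matching_factor_of.
by apply: submatching_matching_of => //; apply: prime_code_valid.
Qed.

(** * The bijection between walks and matchings *)

Local Open Scope ring_scope.

Theorem theorem1p3 :
  exists Phi : forall n : nat, walk -> {set {set 'I_(2 * n)}},
    (forall n : nat, (1 <= n)%N ->
      bijection_between (pdsaw n) (@is_matching (2 * n)) (Phi n) /\
      forall P : walk, pdsaw n P ->
      forall N A M : int, A = 0 \/ A = 1 ->
        [/\ (north_steps P)%:Z = N,
            ((area P)%:Z = A %[mod 2])%Z
          & (last_descent P)%:Z = M - 1]
        <->
        [/\ (nestings (Phi n P))%:Z = N,
            ((crossings (Phi n P))%:Z = A %[mod 2])%Z
          & matched (Phi n P) 1 M])
    /\
    (forall n : nat, (1 <= n)%N ->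
      forall P : walk, pdsaw n P ->
      forall Ps : seq walk, walk_prime_factors P Ps ->
        matching_prime_factors (Phi n P)
          [seq Sized (Phi (count_mem East Q) Q) | Q <- rev Ps]).
Proof.
(* [walk_of] reverses concatenation of codes, while [code_bijection] and [matching_of] preserve the
   order of factors; this produces the reversal. *)
exists (fun n P => matching_of (2 * n) (code_bijection (code_of P))).
split=> n n_gt0; last first.
  move=> _ /pdsawP[c [vc <- ->]] ws /(walk_prime_factorsP vc)[cs [pr -> Ec]].
  have pr_rev : all prime_code (rev cs) by rewrite all_rev.
  rewrite code_of_walk_of // -map_rev; have [_ <- _] := code_bijectionP vc.
  rewrite Ec code_bijection_flatten //.
  have -> : [seq Sized (matching_of (2 * count_mem East Q) (code_bijection (code_of Q)))
              | Q <- [seq walk_of e | e <- rev cs]] =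
            [seq Sized (matching_of (2 * size e) e) | e <- [seq prime_bijection e | e <- rev cs]].
    rewrite -!map_comp; apply/eq_in_map => e /(allP pr_rev) pr_e /=.
    rewrite code_of_walk_of ?prime_code_valid // count_East_walk_to code_bijection_prime //.
    by have [_ <- _] := prime_bijectionP pr_e.
  by apply: matching_prime_factors_of; apply: all_prime_bijection.
split.
  split.
  - move=> _ /pdsawP[c [vc <- ->]]; rewrite code_of_walk_of //.
    by have [v <- _] := code_bijectionP vc; apply: is_matching_of.
  - move=> _ _ /pdsawP[c [vc szc ->]] /pdsawP[d [vd szd ->]]; rewrite !code_of_walk_of //.
    have [vc' szc' _] := code_bijectionP vc; have [vd' szd' _] := code_bijectionP vd.
    move/(matching_of_inj vc' vd'); rewrite szc' szd' => /(_ szc szd) E.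
    by rewrite (code_bijection_inj vc vd E).
  move=> m /matching_of_surj[d [vd szd <-]]; have [c vc Ec] := code_bijection_surj vd.
  have [_ sz _] := code_bijectionP vc.
  exists (walk_of c); last by rewrite code_of_walk_of // Ec.
  by rewrite -szd -Ec sz pdsaw_walk_of.
move=> _ /pdsawP[c [vc szc ->]] N A M _; rewrite code_of_walk_of //.
have [vb szb [Enests Eodd Ehead]] := code_bijectionP vc.
have -> : north_steps (walk_of c) = norths c by rewrite north_steps_walk_to //; case: (c).
rewrite area_walk_of // -szc -szb nestings_matching_of // Enests.
have cross_iff :
    ((crossings (matching_of (2 * size (code_bijection c)) (code_bijection c)))%:Z = A %[mod 2])%Z
    <-> ((sumn c)%:Z = A %[mod 2])%Z.
  by rewrite !modz_nat !modn2 crossings_matching_of // Eodd.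
(* The two codes share their head a: the last descent has length a + 1 and 1 is matched with a + 2.
   The head exists because n >= 1. *)
have matched_iff :
    matched (matching_of (2 * size (code_bijection c)) (code_bijection c)) 1 M
    <-> (last_descent (walk_of c))%:Z = M - 1.
  have : (0 < size (code_bijection c))%N by rewrite szb szc.
  move: vb Ehead; case: (code_bijection c) => // a d vad /=.
  case: (c) szc => [|b e] /= sz; first by move: n_gt0; rewrite -sz.
  by move=> <- _; rewrite matched_matching_of // last_descent_walk_of; lia.
by split=> -[-> /cross_iff EA /matched_iff EM].
Qed.
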